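(* Let $G$ be a finitely generated LERF group with the Morse local-to-global property. Then for every $n \geq 1$ and all stable subgroups $H_1, \dots, H_n$ of $G$, the setwise product $H_1 \cdots H_n = \{h_1 \cdots h_n : h_i \in H_i\}$ is separable in $G$.
   Context: Profinite topology: the topology on a group $G$ whose basic open sets are the cosets of finite index subgroups of $G$. A subset of $G$ is separable if it is closed in this topology. A group is LERF (locally extended residually finite) if every finitely generated subgroup is separable. Cayley graph: for a finite generating set $S$ of $G$, $\mathrm{Cay}(G,S)$ has vertex set $G$, with $g,h$ joined by an edge if $g^{-1}h \in S$ or $h^{-1}g \in S$. It is regarded as a geodesic metric space by giving each edge length one. Quasigeodesics: a map $f\colon X \to Y$ of metric spaces is a $(\lambda,c)$-quasi-isometric embedding ($\lambda \geq 1$, $c \geq 0$) if $\frac{1}{\lambda} d_Y(f(x),f(y)) - c \leq d_X(x,y) \leq \lambda d_Y(f(x),f(y)) + c$ for all $x,y \in X$. A $(\lambda,c)$-quasigeodesic is a $(\lambda,c)$-quasi-isometric embedding of an interval $I \subseteq \mathbb{R}$. Morse quasigeodesics: a Morse gauge is a non-decreasing function $M\colon \mathbb{R}_{\geq 1} \times \mathbb{R}_{\geq 0} \to \mathbb{R}_{\geq 0}$. A quasigeodesic $\gamma\colon I \to X$ is $M$-Morse if for all $\lambda \ge 1$, $c \ge 0$ and any $(\lambda,c)$-quasigeodesic segment $\eta\colon [a,b] \to X$ with $\eta(a) = \gamma(t_1)$, $\eta(b) = \gamma(t_2)$, the Hausdorff distance between $\gamma|_{[t_1,t_2]}$ and $\eta$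 is at most $M(\lambda,c)$. An $(M;\lambda,c)$-Morse quasigeodesic is a $(\lambda,c)$-quasigeodesic that is $M$-Morse. A path $\gamma \colon I \to X$ is an $(L;M;\lambda,c)$-local Morse quasigeodesic if each subpath $\gamma|_{[t_1,t_2]}$ with $t_2 - t_1 \leq L$ is an $(M;\lambda,c)$-Morse quasigeodesic. Morse local-to-global (MLTG) property: a metric space $X$ has it if for every Morse gauge $M$ and constants $\lambda \geq 1$, $c \geq 0$ there exist $L > 0$, a Morse gauge $M'$ and constants $\lambda' \geq 1$, $c' \geq 0$ such that every $(L;M;\lambda,c)$-local Morse quasigeodesic in $X$ is an $(M';\lambda',c')$-Morse quasigeodesic. A finitely generated group has the MLTG property if its Cayley graph with respect to a finite generating set does. Stable subgroups: let $S$ be a finite generating set of $G$, $M$ a Morse gauge and $\mu \geq 0$. A subgroup $H \leqslant G$ is $(M,\mu)$-stable if any geodesic in $\mathrm{Cay}(G,S)$ with endpoints in $H$ is $M$-Morse and lies in the $\mu$-neighbourhood of $H$. $H$ is stable if it is $(M,\mu)$-stable for some $M$ and $\mu$; this does not depend on the choice of $S$. *)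

(* Defs.v *)
From HB Require Import structures.
From mathcomp Require Import all_boot all_order all_algebra.
From mathcomp Require Import monoid all_classical all_reals all_analysis.
From mathcomp Require Import ring.

Set Implicit Arguments.
Unset Strict Implicit.
Unset Printing Implicit Defensive.

Import Order.TTheory GRing.Theory Num.Theory.

Local Open Scope classical_set_scope.
Local Open Scope ring_scope.

Definition is_subgroup (G : groupType) (H : set G) : Prop :=
  group_closed [in H].

Definition generated (G : groupType) (S : set G) : set G :=
  smallest (@is_subgroup G) S.

Definition finitely_generated (G : groupType) (H : set G) : Prop :=
  exists2 S : set G, finite_set S & H = generated S.

Definition left_coset (G : groupType) (g : G) (H : set G) : set G :=
  [set (g * h)%g | h in H].

Definition finite_index (G : groupType) (H : set G) : Prop :=
  finite_set (range (fun g : G => left_coset g H)).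

(* Left and right cosets give the same base: H g = g (g^-1 H g). *)
Definition finite_index_coset (G : groupType) : set (set G) :=
  [set A | exists g H, [/\ is_subgroup H, finite_index H & A = left_coset g H]].

Lemma is_subgroupT (G : groupType) : is_subgroup [set: G].
Proof. by split=> [|x y _ _]; exact: in_setT. Qed.

Lemma is_subgroupI (G : groupType) (H K : set G) :
  is_subgroup H -> is_subgroup K -> is_subgroup (H `&` K).
Proof.
move=> [H1 Hd] [K1 Kd]; split; rewrite ?inE.
  by split; [move: H1 | move: K1]; rewrite inE.
move=> x y /[!inE]-[Hx Kx] [Hy Ky].
have := Hd x y; have := Kd x y; rewrite !inE.
by move=> /(_ Kx Ky) Kxy /(_ Hx Hy).
Qed.

Lemma left_cosetP (G : groupType) (g x : G) (H : set G) :
  left_coset g H x <-> H (g^-1 * x)%g.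
Proof.
split=> [[h Hh <-]|Hx]; first by rewrite mulKg.
by exists (g^-1 * x)%g => //; rewrite mulVKg.
Qed.

Lemma left_coset_eq (G : groupType) (g x : G) (H : set G) :
  is_subgroup H -> left_coset g H x -> left_coset g H = left_coset x H.
Proof.
move=> sH /left_cosetP Hgx; apply/seteqP; split=> y /left_cosetP Hy;
  apply/left_cosetP; have HM := group_closedM sH; have HV := group_closedV sH.
- have := HM (g^-1 * x)^-1%g (g^-1 * y)%g.
  rewrite !inE invgM invgK -mulgA mulVKg; apply=> //.
  by move: (HV (g^-1 * x)%g); rewrite !inE invgM invgK; exact.
- have := HM (g^-1 * x)%g (x^-1 * y)%g.
  by rewrite !inE -mulgA mulVKg; exact.
Qed.

Lemma left_cosetI (G : groupType) (g : G) (H K : set G) :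
  left_coset g (H `&` K) = left_coset g H `&` left_coset g K.
Proof.
apply/seteqP; split=> x; first by move/left_cosetP=> [? ?]; split; apply/left_cosetP.
by move=> [/left_cosetP ? /left_cosetP ?]; apply/left_cosetP.
Qed.

Lemma finite_indexI (G : groupType) (H K : set G) :
  finite_index H -> finite_index K -> finite_index (H `&` K).
Proof.
move=> fH fK; have := finite_image2 (@setI G) fH fK; apply: sub_finite_set.
move=> _ [g _ <-]; rewrite left_cosetI.
by exists (left_coset g H); [exists g|exists (left_coset g K); [exists g|]].
Qed.

Definition profinite (G : groupType) : Type := G.

HB.instance Definition _ (G : groupType) := Choice.on (profinite G).

Lemma finite_index_coset_cover (G : groupType) :
  \bigcup_(A in @finite_index_coset G) A = [set: G].
Proof.
apply/seteqP; split=> // x _; exists setT => //; exists 1%g, setT; split.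
- exact: is_subgroupT.
- apply: (@sub_finite_set _ _ [set setT]); last exact: finite_set1.
  move=> _ [g _ <-]; apply/seteqP; split=> // y _; exact/left_cosetP.
- by apply/seteqP; split=> // y _; exact/left_cosetP.
Qed.

Lemma finite_index_coset_join (G : groupType) (A B : set G) (x : G) :
  finite_index_coset A -> finite_index_coset B -> A x -> B x ->
  exists C, [/\ finite_index_coset C, C x & C `<=` A `&` B].
Proof.
move=> [g [H [sH fH ->]]] [k [K [sK fK ->]]] Ax Bx.
exists (left_coset x (H `&` K)); split.
- exists x, (H `&` K); split=> //; [exact: is_subgroupI|exact: finite_indexI].
- apply/left_cosetP; rewrite mulVg.
  by split; [have [] := sH|have [] := sK]; rewrite inE.
- by rewrite left_cosetI (left_coset_eq sH Ax) (left_coset_eq sK Bx).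
Qed.

HB.instance Definition _ (G : groupType) :=
  isBaseTopological.Build (profinite G)
    (@finite_index_coset_cover G) (@finite_index_coset_join G).

Definition separable (G : groupType) (A : set G) : Prop :=
  closed (A : set (profinite G)).

Definition lerf (G : groupType) : Prop :=
  forall H : set G, is_subgroup H -> finitely_generated H -> separable H.

(* Paths are total functions on R of which only the restriction to the
   domain I matters; no continuity is required. *)

Definition quasi_isometric_embedding (R : realType) (X Y : metricType R)
    (lambda c : R) (D : set X) (f : X -> Y) : Prop :=
  forall x y, D x -> D y ->
    lambda^-1 * mdist (f x) (f y) - c <= mdist x y /\
    mdist x y <= lambda * mdist (f x) (f y) + c.

Definition quasigeodesic (R : realType) (X : metricType R) (lambda c : R)
    (I : set R) (gamma : R -> X) : Prop :=
  is_interval I /\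
  quasi_isometric_embedding lambda c (I : set R^o) (gamma : R^o -> X).

Definition geodesic (R : realType) (X : metricType R) (a b : R)
    (gamma : R -> X) : Prop :=
  a <= b /\
  {in `[a, b] &, forall s t, mdist (gamma s) (gamma t) = `|s - t|}.

Definition hausdorff_distance (R : realType) (X : metricType R)
    (A B : set X) : \bar R :=
  maxe (ereal_sup [set ereal_inf [set (mdist x y)%:E | y in B] | x in A])
       (ereal_sup [set ereal_inf [set (mdist x y)%:E | x in A] | y in B]).

(* Only the values M lambda c with 1 <= lambda and 0 <= c are meaningful. *)
Definition morse_gauge (R : realType) (M : R -> R -> R) : Prop :=
  (forall lambda c, 1 <= lambda -> 0 <= c -> 0 <= M lambda c) /\
  (forall lambda c lambda' c', 1 <= lambda -> 0 <= c ->
     lambda <= lambda' -> c <= c' -> M lambda c <= M lambda' c').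

Definition morse (R : realType) (X : metricType R) (M : R -> R -> R)
    (I : set R) (gamma : R -> X) : Prop :=
  forall (lambda c : R), 1 <= lambda -> 0 <= c ->
  forall (a b t1 t2 : R) (eta : R -> X),
    a <= b -> t1 <= t2 -> I t1 -> I t2 ->
    quasigeodesic lambda c `[a, b] eta ->
    eta a = gamma t1 -> eta b = gamma t2 ->
    (hausdorff_distance (gamma @` `[t1, t2]) (eta @` `[a, b])
       <= (M lambda c)%:E)%E.

Definition morse_quasigeodesic (R : realType) (X : metricType R)
    (M : R -> R -> R) (lambda c : R) (I : set R) (gamma : R -> X) : Prop :=
  quasigeodesic lambda c I gamma /\ morse M I gamma.

Definition local_morse_quasigeodesic (R : realType) (X : metricType R)
    (L : R) (M : R -> R -> R) (lambda c : R)
    (I : set R) (gamma : R -> X) : Prop :=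
  is_interval I /\
  forall t1 t2, I t1 -> I t2 -> t1 <= t2 -> t2 - t1 <= L ->
    morse_quasigeodesic M lambda c `[t1, t2] gamma.

Definition morse_local_to_global (R : realType) (X : metricType R) : Prop :=
  forall (M : R -> R -> R) (lambda c : R),
    morse_gauge M -> 1 <= lambda -> 0 <= c ->
  exists (L : R) (M' : R -> R -> R) (lambda' c' : R),
    [/\ 0 < L, morse_gauge M', 1 <= lambda', 0 <= c' &
      forall (I : set R) (gamma : R -> X),
        local_morse_quasigeodesic L M lambda c I gamma ->
        morse_quasigeodesic M' lambda' c' I gamma].

Record generating_set (G : groupType) := GeneratingSet {
  gens : set G;
  gens_finite : finite_set gens;
  gens_generate : generated gens = [set: G]
}.

Definition cayley_adj (G : groupType) (S : generating_set G) (g h : G) : Prop :=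
  gens S (g^-1 * h)%g \/ gens S (h^-1 * g)%g.

(* Barycentric coordinates of the point at distance t from g on the edge
   joining g to h; for g = h this is the vertex g, so loops are collapsed. *)
Definition edge_point (R : realType) (G : groupType) (g h : G) (t : R) : G -> R :=
  fun k => (1 - t) * (k == g)%:R + t * (k == h)%:R.

Record cayley (R : realType) (G : groupType) (S : generating_set G) := CayleyPoint {
  bary : G -> R;
  baryP : exists g h t, [/\ g = h \/ cayley_adj S g h, 0 <= t <= 1 &
                            bary = edge_point g h t]
}.

Lemma vertex_subproof (R : realType) (G : groupType) (S : generating_set G) (g : G) :
  exists g' h (t : R), [/\ g' = h \/ cayley_adj S g' h, 0 <= t <= 1 &
    edge_point g g (0 : R) = edge_point g' h t].
Proof. by exists g, g, 0; split; [left|rewrite lexx ler01|]. Qed.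

Definition vertex (R : realType) (G : groupType) (S : generating_set G) (g : G) :
  cayley R S := CayleyPoint (vertex_subproof R S g).

(* cayley_path x y l: x and y are joined by a path of length l which is a
   concatenation of finitely many segments, each contained in one edge. *)
Inductive cayley_path (R : realType) (G : groupType) (S : generating_set G) :
    cayley R S -> cayley R S -> R -> Prop :=
| cayley_path_nil x : cayley_path x x 0
| cayley_path_cons g h s t x y z l :
    cayley_adj S g h -> 0 <= s <= 1 -> 0 <= t <= 1 ->
    bary x = edge_point g h s -> bary y = edge_point g h t ->
    cayley_path y z l -> cayley_path x z (`|s - t| + l).

Definition cayley_dist (R : realType) (G : groupType) (S : generating_set G)
    (x y : cayley R S) : R :=
  inf [set l | cayley_path x y l].

Section CayleyMetric.
Context (R : realType) (G : groupType) (S : generating_set G).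
Implicit Types x y z : cayley R S.

Lemma bary_inj x y : bary x = bary y -> x = y.
Proof.
by case: x y => [f fP] [g gP] /= fg; rewrite -fg in gP *; congr CayleyPoint.
Qed.

Lemma cayley_path_ge0 x y l : cayley_path x y l -> 0 <= l.
Proof. by elim=> // *; exact: addr_ge0. Qed.

Lemma cayley_path_cat x y z l m :
  cayley_path x y l -> cayley_path y z m -> cayley_path x z (l + m).
Proof.
move=> pxy pyz; elim: pxy pyz => [u|g h s t u v w k] *; first by rewrite add0r.
by rewrite -addrA; apply: cayley_path_cons; eauto.
Qed.

Lemma cayley_path_sym x y l : cayley_path x y l -> cayley_path y x l.
Proof.
elim=> [u|g h s t u v w k adj s01 t01 us vt _ wv]; first exact: cayley_path_nil.
rewrite addrC -[`|s - t|]addr0 distrC; apply: cayley_path_cat wv _.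
exact: (cayley_path_cons adj t01 s01 vt us (cayley_path_nil _)).
Qed.

Lemma cayley_path_bary x y l k :
  cayley_path x y l -> `|bary x k - bary y k| <= l.
Proof.
elim=> [u|g h s t u v w m _ _ _ us vt _ IH]; first by rewrite subrr normr0.
have -> : bary u k - bary w k = (bary u k - bary v k) + (bary v k - bary w k).
  by rewrite addrA subrK.
apply: le_trans (ler_normD _ _) (lerD _ IH); rewrite us vt /edge_point.
have -> : (1 - s) * (k == g)%:R + s * (k == h)%:R -
    ((1 - t) * (k == g)%:R + t * (k == h)%:R) =
    (s - t) * ((k == h)%:R - (k == g)%:R).
  by ring.
rewrite normrM ler_piMr//.
by do 2 case: (_ == _); rewrite ?subrr ?sub0r ?subr0 ?normrN ?normr1 ?normr0.
Qed.

Lemma generatedP (H : set G) : is_subgroup H -> gens S `<=` H -> H = setT.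
Proof.
move=> sH SH; apply/seteqP; split=> // x _.
by apply: (smallest_sub sH SH); rewrite -/(generated (gens S)) gens_generate.
Qed.

Lemma cayley_path_vertex g h : exists l, cayley_path (vertex R S g) (vertex R S h) l.
Proof.
have edge0 (u v : G) : edge_point u u 0 = edge_point u v 0 :> (G -> R).
  by apply/funext => k; rewrite /edge_point !mul0r.
have edge1 (u v : G) : edge_point v v 0 = edge_point u v 1 :> (G -> R).
  by apply/funext => k; rewrite /edge_point subrr subr0 !mul0r !mul1r addrC.
pose A := [set k | forall u, exists l,
  cayley_path (vertex R S u) (vertex R S (u * k)%g) l].
suff AT : A = setT.
  have : A (g^-1 * h)%g by rewrite AT.
  by move=> /(_ g); rewrite mulVKg.
apply: generatedP.
  split; first by rewrite inE => u; exists 0; rewrite mulg1; exact: cayley_path_nil.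
  move=> a b; rewrite !inE => Aa Ab u.
  have [l pl] := Aa u; have [m pm] := Ab (u * (a / b))%g.
  exists (l + m); apply: cayley_path_cat pl _; apply: cayley_path_sym.
  by move: pm; rewrite -!mulgA mulVg mulg1.
move=> s Ss u; exists (`|0 - 1| + 0).
apply: (@cayley_path_cons _ _ _ u (u * s)%g 0 1 _ (vertex R S (u * s)%g)).
- by left; rewrite mulKg.
- by rewrite lexx ler01.
- by rewrite lexx ler01.
- exact: edge0.
- exact: edge1.
- exact: cayley_path_nil.
Qed.

Lemma cayley_path_exists x y : exists l, cayley_path x y l.
Proof.
have tov z : exists g l, cayley_path z (vertex R S g) l.
  have [g [h [t [[<-|gh] t01 zt]]]] := baryP z.
    exists g, 0; suff -> : z = vertex R S g by exact: cayley_path_nil.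
    apply: bary_inj; rewrite zt; apply/funext => k /=.
    by rewrite /edge_point -!mulrDl subrK subr0 addr0.
  exists g, (`|t - 0| + 0).
  apply: (cayley_path_cons (y := vertex R S g) gh t01 _ zt _ (cayley_path_nil _)).
    by rewrite lexx ler01.
  by apply/funext => k; rewrite /= /edge_point !mul0r.
have [g [l xg]] := tov x; have [h [m yh]] := tov y.
have [n gh] := cayley_path_vertex g h.
exists (l + (n + m)); apply: cayley_path_cat xg _.
exact: cayley_path_cat gh (cayley_path_sym yh).
Qed.

Lemma cayley_has_inf x y : has_inf [set l | cayley_path x y l].
Proof.
split; first exact: cayley_path_exists.
by exists 0 => l /cayley_path_ge0.
Qed.

Lemma cayley_dist_le x y l : cayley_path x y l -> cayley_dist x y <= l.
Proof. by move=> xyl; apply: ge_inf => //; have [] := cayley_has_inf x y. Qed.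

Lemma cayley_distxx x : cayley_dist x x = 0.
Proof.
apply/eqP; rewrite eq_le cayley_dist_le; last exact: cayley_path_nil.
by apply: lb_le_inf => [|l /cayley_path_ge0//]; exact: cayley_path_exists.
Qed.

Lemma cayley_dist_positivity x y : cayley_dist x y = 0 -> x = y.
Proof.
move=> xy0; apply: bary_inj; apply/funext => k; apply/eqP.
rewrite -subr_eq0 -normr_le0 -xy0.
by apply: lb_le_inf => [|l /cayley_path_bary//]; exact: cayley_path_exists.
Qed.

Lemma cayley_dist_sym x y : cayley_dist x y = cayley_dist y x.
Proof.
by congr inf; apply/seteqP; split=> l /cayley_path_sym.
Qed.

Lemma cayley_dist_triangle y x z :
  cayley_dist x z <= cayley_dist x y + cayley_dist y z.
Proof.
rewrite -lerBlDr; apply: lb_le_inf => [|l xyl]; first exact: cayley_path_exists.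
rewrite lerBlDr -lerBlDl; apply: lb_le_inf => [|m yzm].
  exact: cayley_path_exists.
by rewrite lerBlDl; apply: cayley_dist_le; exact: cayley_path_cat xyl yzm.
Qed.

HB.instance Definition _ := gen_eqMixin (cayley R S).
HB.instance Definition _ := gen_choiceMixin (cayley R S).
HB.instance Definition _ := isMetric.Build R (cayley R S)
  cayley_distxx cayley_dist_positivity cayley_dist_sym cayley_dist_triangle.

End CayleyMetric.

Definition morse_local_to_global_group (R : realType) (G : groupType) : Prop :=
  exists S : generating_set G, morse_local_to_global (cayley R S).

Definition stable_wrt (R : realType) (G : groupType) (S : generating_set G)
    (M : R -> R -> R) (mu : R) (H : set G) : Prop :=
  forall (a b : R) (gamma : R -> cayley R S),
    geodesic a b gamma ->
    (exists2 g, H g & gamma a = vertex R S g) ->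
    (exists2 h, H h & gamma b = vertex R S h) ->
    morse M `[a, b] gamma /\
    {in `[a, b], forall t, exists2 h, H h & mdist (gamma t) (vertex R S h) <= mu}.

Definition stable (R : realType) (G : groupType) (H : set G) : Prop :=
  is_subgroup H /\
  exists (S : generating_set G) (M : R -> R -> R) (mu : R),
    [/\ morse_gauge M, 0 <= mu & stable_wrt S M mu H].

Definition set_product (G : groupType) (n : nat) (H : 'I_n -> set G) : set G :=
  [set (\prod_(i < n) h i)%g | h in [set h : 'I_n -> G | forall i, H i (h i)]].

(* Main.v *)
Require Import Defs.
From mathcomp Require Import all_boot all_order all_algebra.
From mathcomp Require Import monoid all_classical all_reals all_analysis.
From mathcomp Require Import zify ring lra.

(* For the word metric d, a path which is a concatenation of Morse geodesics
   with bounded backtracking at each junction and long interior pieces is a local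
   Morse quasigeodesic, hence by the local-to-global property a global one. Two
   consecutive geodesics labelled by y in H and y' in H' do not backtrack if
   |y| + |y'| is minimal among the pairs (y z, z^-1 y') with z in H and H': this
   is a pigeonhole argument.

   Let H_1, ..., H_n be stable and S the intersection of H_1 and H_2. For a
   finite index normal subgroup N, let P and Q be the intersections of N S with
   H_1 and H_2, and A = <P, Q>. An element of A is an alternating product of
   elements of P and Q, whose interior factors avoid S. As S is separable, these
   are long if N is small, so A is stable. The set H_1 A H_2 ... H_n is a finite
   union of translates of products A K_3 ... K_n of n - 1 stable subgroups, with
   K_i a conjugate of H_i, and so is closed by induction. It remains to see that
   it omits a given g outside H_1 ... H_n if N is small. Otherwise write
   g = h y_1 ... y_m k with y_i alternately in Q \ S and P \ S, k in H_2 ... H_n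
   and m minimal, and shorten this product as much as possible. If all the factors
   except h are long, then |g| is too large. Short factors of k are moved to the
   right, conjugating the next ones. Shortening changes the last letter y_m of P
   to an element of N Z, where Z is a product of at most n - 1 stable subgroups.
   As Z is separable, that element is long, unless it lies in Z, when it can be
   absorbed into k, against the minimality of m. *)

Set Implicit Arguments.
Unset Strict Implicit.
Unset Printing Implicit Defensive.

Import Order.TTheory GRing.Theory Num.Theory.

Local Open Scope classical_set_scope.
Local Open Scope ring_scope.

(** * Quasigeodesics and Morse paths *)

Definition between (R : realType) (s t v : R) : Prop :=
  s <= v <= t \/ t <= v <= s.

Section PseudoMetric.
Context (R : realType) (X : Type) (d : X -> X -> R).

Definition pseudometric : Prop :=
  [/\ forall x, d x x = 0, forall x y, d x y = d y x &
      forall x y z, d x z <= d x y + d y z].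

(** The first inequality is [l^-1 * d (f s) (f t) - c <= |s - t|] multiplied through by [l], so the
    constants agree exactly with those of [quasigeodesic]. *)
Definition qgeod (l c a b : R) (f : R -> X) : Prop :=
  forall s t, a <= s <= b -> a <= t <= b ->
    d (f s) (f t) <= l * (`|s - t| + c) /\ `|s - t| <= l * d (f s) (f t) + c.

Definition fellow (E : R) (f : R -> X) (s t : R) (g : R -> X) (a b : R) : Prop :=
  (forall v, between s t v -> exists2 w, a <= w <= b & d (f v) (g w) <= E) /\
  (forall w, a <= w <= b -> exists2 v, between s t v & d (f v) (g w) <= E).

(** [D] ranges over arbitrary functions, so bounds can be composed freely; a monotone gauge is
    rebuilt in [discrete_mltg_cayley]. *)
Definition morse_path (D : R -> R -> R) (a b : R) (f : R -> X) : Prop :=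
  forall l c, 1 <= l -> 0 <= c -> forall s t, a <= s <= b -> a <= t <= b ->
  forall a' b' g, a' <= b' -> qgeod l c a' b' g -> g a' = f s -> g b' = f t ->
    fellow (D l c) f s t g a' b'.

Lemma eq_qgeod (l c a b : R) (f g : R -> X) :
  (forall t, a <= t <= b -> f t = g t) -> qgeod l c a b f -> qgeod l c a b g.
Proof. by move=> fg qf s t sab tab; rewrite -!fg //; exact: qf. Qed.

Lemma sub_qgeod (l c a b a' b' : R) (f : R -> X) :
  a <= a' -> b' <= b -> qgeod l c a b f -> qgeod l c a' b' f.
Proof. by move=> aa bb qf s t sab tab; apply: qf; lra. Qed.

Lemma sub_morse_path (D : R -> R -> R) (a b a' b' : R) (f : R -> X) :
  a <= a' -> b' <= b -> morse_path D a b f -> morse_path D a' b' f.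
Proof. by move=> aa bb qf l c l1 c0 s t sab tab; apply: qf; lra. Qed.

Lemma shift_qgeod (l c a b u : R) (f : R -> X) :
  qgeod l c (a - u) (b - u) f -> qgeod l c a b (fun t => f (t - u)).
Proof.
move=> qf s t sab tab.
have -> : s - t = (s - u) - (t - u) by ring.
by apply: qf; lra.
Qed.

Lemma rev_qgeod (l c a b : R) (f : R -> X) :
  qgeod l c a b f -> qgeod l c a b (fun t => f (a + b - t)).
Proof.
move=> qf s t sab tab.
have -> : `|s - t| = `|(a + b - s) - (a + b - t)|.
  by rewrite -normrN; congr `| _ |; ring.
by apply: qf; lra.
Qed.

Lemma between_sym (s t v : R) : between s t v -> between t s v.
Proof. by case; [right|left]. Qed.

Lemma fellow_rev (E : R) (f : R -> X) (s t : R) (g : R -> X) (a b : R) :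
  fellow E f s t (fun v => g (a + b - v)) a b -> fellow E f t s g a b.
Proof.
move=> [H1 H2]; split=> [v /between_sym/H1[w wab dw]|w wab].
  by exists (a + b - w) => //; lra.
have [|v vst dv] := H2 (a + b - w); first by lra.
exists v; first exact: between_sym.
by move: dv; congr (d _ (g _) <= _); ring.
Qed.

Lemma fellow_le (E E' : R) (f : R -> X) (s t : R) (g : R -> X) (a b : R) :
  E <= E' -> fellow E f s t g a b -> fellow E' f s t g a b.
Proof.
move=> EE [H1 H2]; split=> [v /H1|w /H2] [u ? ?]; exists u => //; lra.
Qed.

Lemma morse_path_ordered (D : R -> R -> R) (a b : R) (f : R -> X) :
  (forall l c, 1 <= l -> 0 <= c -> forall s t, a <= s -> s <= t -> t <= b ->
    forall a' b' g, a' <= b' -> qgeod l c a' b' g -> g a' = f s -> g b' = f t ->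
    fellow (D l c) f s t g a' b') -> morse_path D a b f.
Proof.
move=> H l c l1 c0 s t sab tab a' b' g ab qg gs gt.
have [st|ts] := leP s t; first by apply: H => //; lra.
apply: fellow_rev; apply: (H l c l1 c0 t s _ _ _ a' b'); [lra|lra|lra|by []|..].
- exact: rev_qgeod.
- by rewrite [a' + b']addrC addrK gt.
- by rewrite addrK gs.
Qed.

Lemma shift_morse_path (D : R -> R -> R) (a b u : R) (f : R -> X) :
  morse_path D (a - u) (b - u) f -> morse_path D a b (fun t => f (t - u)).
Proof.
move=> mf l c l1 c0 s t sab tab a' b' g ab qg gs gt.
have [||H1 H2] := mf l c l1 c0 (s - u) (t - u) _ _ a' b' g ab qg gs gt; [lra|lra|].
split=> [v vst|w /H2[v vst dv]].
  by apply: (H1 (v - u)); case: vst; [left|right]; lra.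
exists (v + u); last by rewrite addrK.
by case: vst; [left|right]; lra.
Qed.

Lemma eq_morse_path (D : R -> R -> R) (a b : R) (f f' : R -> X) :
  (forall t, a <= t <= b -> f t = f' t) -> morse_path D a b f ->
  morse_path D a b f'.
Proof.
move=> ff mf l c l1 c0 s t sab tab a' b' g ab qg gs gt.
rewrite -!ff // in gs gt.
have [H1 H2] := mf l c l1 c0 s t sab tab a' b' g ab qg gs gt.
have vab v : between s t v -> a <= v <= b by case; lra.
split=> [v vst|w /H2[v vst dv]]; first by rewrite -ff; [exact: H1|exact: vab].
by exists v; rewrite // -ff //; exact: vab.
Qed.

Context (dP : pseudometric).

Lemma pmxx x : d x x = 0. Proof. by have [] := dP. Qed.
Lemma pm_sym x y : d x y = d y x. Proof. by have [] := dP. Qed.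
Lemma pm_tri x y z : d x z <= d x y + d y z. Proof. by have [] := dP. Qed.
Lemma pm_ge0 x y : 0 <= d x y.
Proof. by have := pm_tri x y x; rewrite pmxx [d y x]pm_sym; lra. Qed.

Definition clamp (a b t : R) : R := Num.max a (Num.min b t).

Lemma clampP a b t : a <= b ->
  [/\ t <= a & clamp a b t = a] \/ [/\ b <= t & clamp a b t = b] \/
  [/\ a <= t <= b & clamp a b t = t].
Proof.
move=> ab; rewrite /clamp; case: (leP b t) => bt.
  by right; left; split=> //; rewrite max_r.
case: (leP a t) => ta; first by right; right; split => //; lra.
by left; split=> //; lra.
Qed.

Lemma clamp_dist_le a b s t : a <= b -> `|clamp a b s - clamp a b t| <= `|s - t|.
Proof.
move=> ab; have := ler_norm (s - t); have := ler_norm (- (s - t)).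
rewrite normrN ler_norml.
by case: (clampP s ab) => [[? ->]|[[? ->]|[? ->]]];
  case: (clampP t ab) => [[? ->]|[[? ->]|[? ->]]]; lra.
Qed.

Lemma clamp_dist_ge a b s t : a <= b -> a - 1 <= s <= b + 1 ->
  a - 1 <= t <= b + 1 -> `|s - t| <= `|clamp a b s - clamp a b t| + 2.
Proof.
move=> ab sab tab; set u := _ - clamp a b t.
have := ler_norm u; have := ler_norm (- u); rewrite normrN ler_norml /u.
by case: (clampP s ab) => [[? ->]|[[? ->]|[? ->]]];
  case: (clampP t ab) => [[? ->]|[[? ->]|[? ->]]]; lra.
Qed.

(* Prescribing the values of [g] on collars of length one outside its domain
   changes its endpoints without conflict when the domain is a point. *)
Lemma qgeod_endpoints (l c a b r : R) (g : R -> X) (x y : X) :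
  1 <= l -> 0 <= c -> 0 <= r -> a <= b -> qgeod l c a b g ->
  d (g a) x <= r -> d (g b) y <= r ->
  exists g', [/\ qgeod l (c + 2 * l * r + 2) (a - 1) (b + 1) g',
    g' (a - 1) = x, g' (b + 1) = y &
    forall t, a - 1 <= t <= b + 1 -> d (g (clamp a b t)) (g' t) <= r] /\
    (forall t, a <= t <= b -> g' t = g t).
Proof.
move=> l1 c0 r0 ab qg gx gy.
pose g' t := if t < a then x else if b < t then y else g t.
have gg' t : a <= t <= b -> g' t = g t.
  by move=> /andP[at_ tb]; rewrite /g' !ltNge at_ tb.
have close t : a - 1 <= t <= b + 1 -> d (g (clamp a b t)) (g' t) <= r.
  move=> tab; case: (clampP t ab) => [[ta ->]|[[bt ->]|[tt ->]]]; last 1 first.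
  - by rewrite gg' // pmxx.
  - rewrite /g'; case: ltP => // at_; have -> : t = a by lra.
    by rewrite ltNge ab /= pmxx.
  - rewrite /g'; case: ltP => [ta|_]; first by lra.
    case: ltP => // tb; have -> : t = b by lra.
    by rewrite pmxx.
exists g'; split=> //; split=> //.
- move=> s t sab tab; have := close s sab; have := close t tab.
  set s' := clamp a b s; set t' := clamp a b t => ct cs.
  have s'ab : a <= s' <= b by rewrite /s'; case: (clampP s ab) => [[? ->]|[[?
    ->]|[? ->]]]; lra.
  have t'ab : a <= t' <= b by rewrite /t'; case: (clampP t ab) => [[? ->]|[[?
    ->]|[? ->]]]; lra.
  have [q1 q2] := qg s' t' s'ab t'ab.
  have n1 : `|s' - t'| <= `|s - t| by exact: clamp_dist_le.
  have n2 : `|s - t| <= `|s' - t'| + 2 by exact: clamp_dist_ge.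
  have := pm_tri (g' s) (g s') (g' t); have := pm_tri (g s') (g t') (g' t).
  have := pm_tri (g s') (g' s) (g t'); have := pm_tri (g' s) (g' t) (g t').
  rewrite [d (g' s) (g s')]pm_sym [d (g' t) (g t')]pm_sym.
  move=> T4 T3 T2 T1.
  have lr : r <= l * r by rewrite ler_peMl.
  have q2' : l * d (g s') (g t') <= l * (d (g' s) (g' t) + 2 * r).
    by apply: ler_wpM2l; lra.
  have q1' : l * (`|s' - t'| + c) <= l * (`|s - t| + c) by apply: ler_wpM2l; lra.
  have r2 : 0 <= 2 * l * r + 2 by have := mulr_ge0 (ltW (lt_le_trans ltr01 l1))
    r0; lra.
  have lX : 2 * l * r + 2 <= l * (2 * l * r + 2) by rewrite ler_peMl.
  split; last by lra.
  by lra.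
- by rewrite /g' ltrBlDr ltrDl ltr01.
- rewrite /g' ltrDl ltr01; case: ltP => // ?; exfalso; lra.
Qed.

(** The collars of [qgeod_endpoints] carry the endpoints of [g] onto [f], which enlarges the
    additive constant. A point of [f] matched with a collar is within a further [r] of an endpoint
    of [g]. *)
Lemma morse_coarse (D : R -> R -> R) (a b : R) (f : R -> X)
  (l c r s t a' b' : R) (g : R -> X) :
  morse_path D a b f -> 1 <= l -> 0 <= c -> 0 <= r ->
  a <= s <= b -> a <= t <= b -> a' <= b' -> qgeod l c a' b' g ->
  d (g a') (f s) <= r -> d (g b') (f t) <= r ->
  fellow (D l (c + 2 * l * r + 2) + r) f s t g a' b'.
Proof.
move=> mf l1 c0 r0 sab tab ab qg gs gt.
have [g' [[qg' g's g't close] gg']] := qgeod_endpoints l1 c0 r0 ab qg gs gt.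
have [||H1 H2] := mf l _ l1 _ s t sab tab _ _ g' _ qg' g's g't; [nra|lra|].
split=> [v /H1[w wab dw]|w wab].
  exists (clamp a' b' w).
    by case: (clampP w ab) => [[? ->]|[[? ->]|[? ->]]]; lra.
  have := close _ wab; have := pm_tri (f v) (g' w) (g (clamp a' b' w)).
  by rewrite [d (g' w) _]pm_sym; lra.
have [|v vst dv] := H2 w; first by lra.
by exists v => //; move: dv; rewrite gg' //; lra.
Qed.

End PseudoMetric.

(** * Concatenation of Morse paths *)

Lemma le_mulR (R : realType) (x l : R) : 1 <= l -> 0 <= x -> x <= l * x.
Proof. by move=> l1 x0; rewrite ler_peMl. Qed.

Section Glue.
Context (R : realType) (X : Type) (d : X -> X -> R) (dP : pseudometric d).

Definition glue (m : R) (f g : R -> X) (t : R) : X := if t <= m then f t else g t.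

Lemma glue_le (m t : R) (f g : R -> X) : t <= m -> glue m f g t = f t.
Proof. by rewrite /glue => ->. Qed.

Lemma glue_ge (m t : R) (f g : R -> X) : f m = g m -> m <= t -> glue m f g t = g t.
Proof.
rewrite /glue le_eqVlt => fg /orP[/eqP <-|]; first by rewrite lexx.
by rewrite leNgt => ->.
Qed.

Lemma qgeod_weaken (l c l' c' a b : R) (f : R -> X) :
  0 <= l -> 0 <= c -> l <= l' -> c <= c' -> qgeod d l c a b f ->
    qgeod d l' c' a b f.
Proof.
move=> l0 c0 ll cc qf s t sab tab; have [q1 q2] := qf s t sab tab.
have d0 := pm_ge0 dP (f s) (f t); have n0 := normr_ge0 (s - t).
have := ler_wpM2r d0 ll.
have : l * (`|s - t| + c) <= l' * (`|s - t| + c').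
  by apply: ler_pM; lra.
by split; lra.
Qed.

Lemma qgeod_glue (l c a m b : R) (f g : R -> X) :
  f m = g m -> qgeod d l c a m f -> qgeod d l c m b g ->
  (forall s t, a <= s <= m -> m <= t <= b ->
    d (f s) (g t) <= l * (t - s + c) /\ t - s <= l * d (f s) (g t) + c) ->
  qgeod d l c a b (glue m f g).
Proof.
move=> fg qf qg fgm s t sab tab.
case: (leP s m) => sm; case: (leP t m) => tm.
- by rewrite !glue_le //; apply: qf; lra.
- rewrite (glue_le _ _ sm) (glue_ge fg (ltW tm)) distrC ger0_norm; last by lra.
  by apply: fgm; lra.
- rewrite (glue_le _ _ tm) (glue_ge fg (ltW sm)) ger0_norm; last by lra.
  by rewrite (pm_sym dP); apply: fgm; lra.
- by rewrite (glue_ge fg (ltW sm)) (glue_ge fg (ltW tm)); apply: qg; lra.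
Qed.

(** On the vertices of a graph there are no continuous geodesics; paths that are geodesic up to the
    additive error [C] replace them. *)
Definition coarsely_geodesic (C : R) : Prop :=
  forall x y, exists m z, [/\ 0 <= m, qgeod d 1 C 0 m z, z 0 = x & z m = y].

Context (C0 : R) (C0_ge0 : 0 <= C0) (dG : coarsely_geodesic C0).

(** The slack [1] is there because [g] is an arbitrary map and the infimum of the distances to [o]
    need not be attained. *)
Definition nearest (o : X) (a b : R) (g : R -> X) (t0 : R) : Prop :=
  a <= t0 <= b /\ forall t, a <= t <= b -> d o (g t0) <= d o (g t) + 1.

Lemma nearest_exists (o : X) (a b : R) (g : R -> X) :
  a <= b -> exists t0, nearest o a b g t0.
Proof.
move=> ab; pose A := [set d o (g t) | t in [set t | a <= t <= b]].
have Ainf : has_inf A.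
  split; first by exists (d o (g a)), a => //=; rewrite lexx.
  by exists 0 => _ [t _ <-]; exact: pm_ge0.
have [_ [t0 t0ab <-] dt0] := inf_adherent ltr01 Ainf.
exists t0; split=> // t tab.
have : inf A <= d o (g t) by apply: (ge_inf Ainf.2); exists t.
lra.
Qed.

Lemma nearest_rev (o : X) (a b : R) (g : R -> X) (t0 : R) :
  nearest o a b g t0 -> nearest o a b (fun t => g (a + b - t)) (a + b - t0).
Proof.
move=> [t0ab H]; split=> [|t tab]; first by lra.
have -> : a + b - (a + b - t0) = t0 by ring.
by apply: H; lra.
Qed.

(** Leaving [g] at a point nearest to [z m] and following [z] from there cannot fold back towards
    [g]: a point [z w] close to [g] would give a better approximation of [z m] unless [w] is
    small. *)
Lemma qgeod_detour (l c a b t0 m : R) (g z : R -> X) :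
  1 <= l -> 0 <= c -> 0 <= m -> nearest (z m) a b g t0 -> qgeod d l c a b g ->
  qgeod d 1 C0 0 m z -> z 0 = g t0 ->
  qgeod d (3 * l) (c + l * (5 * C0 + 2)) a (t0 + m)
    (glue t0 g (fun t => z (t - t0))).
Proof.
move=> l1 c0 m0 [t0ab near] qg qz z0; have C00 := C0_ge0.
have lC : 5 * C0 + 2 <= l * (5 * C0 + 2) by apply: le_mulR => //; lra.
apply: qgeod_glue => //.
- by rewrite subrr.
- by apply: qgeod_weaken (sub_qgeod (lexx _) _ qg); lra.
- apply: (@qgeod_weaken 1 C0); [lra..|].
  by apply: shift_qgeod; rewrite subrr [t0 + m]addrC addrK.
move=> s t sab tab; set w := t - t0.
have [||_ qz0] := qz 0 w; [rewrite /w; lra..|].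
have [qz1 _] := qz 0 w ltac:(rewrite /w; lra) ltac:(rewrite /w; lra).
have [qzm _] := qz w m ltac:(rewrite /w; lra) ltac:(rewrite /w; lra).
have [_ qzm0] := qz 0 m ltac:(rewrite /w; lra) ltac:(rewrite /w; lra).
have [qg1 qg2] := qg s t0 ltac:(lra) ltac:(lra).
have ns := near s ltac:(lra).
move: qz0 qz1 qzm qzm0 qg1 qg2.
rewrite z0 !sub0r !normrN [`|w|]ger0_norm ?[`|m|]ger0_norm //;
  last by rewrite /w; lra.
rewrite [`|w - m|]distrC [`|m - w|]ger0_norm; last by rewrite /w; lra.
rewrite [`|s - t0|]distrC [`|t0 - s|]ger0_norm; last by lra.
rewrite !mul1r.
have T1 := pm_tri dP (g s) (g t0) (z w).
have T2 := pm_tri dP (z m) (z w) (g s).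
have T3 := pm_tri dP (g s) (z w) (g t0).
rewrite [d (z m) (z w)](pm_sym dP) [d (z w) (g s)](pm_sym dP) in T2.
rewrite [d (z m) (g t0)](pm_sym dP) in ns.
rewrite [d (z w) (g t0)](pm_sym dP) in T3.
move=> qz0 qz1 qzm qzm0 qg1 qg2.
have D0 := pm_ge0 dP (g s) (z w); set D := d (g s) (z w) in T1 T2 T3 D0 *.
have tw : t = t0 + w by rewrite /w; ring.
have w0 : 0 <= w by rewrite /w; lra.
have lw : w <= l * w by apply: le_mulR.
have lC0 : C0 <= l * C0 by apply: le_mulR.
have lD : D <= l * D by apply: le_mulR.
have ls : 0 <= l * (t0 - s) by apply: mulr_ge0; lra.
have lc : 0 <= l * c by apply: mulr_ge0; lra.
have llC : 5 * C0 + 2 <= l * (l * (5 * C0 + 2)).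
  by apply: le_trans lC _; apply: le_mulR => //; lra.
(* Nearness gives [w <= D + 2 * C0 + 1], so [z w] is within [D + 3 * C0 + 1] of [g t0], and [g s]
   within [2 * D + 3 * C0 + 1]. *)
have H : l * d (g s) (g t0) <= l * (2 * D + 3 * C0 + 1) by apply: ler_wpM2l; lra.
rewrite tw; split; lra.
Qed.

(** The part of [g] before [t0], completed by a coarse geodesic to [f t], is a quasigeodesic with
    endpoints on [f]. A point of [f] matched with the added piece is transferred to [g t0], which
    costs the length of the detour. *)
Lemma morse_nearest (D : R -> R -> R) (A B s t l c a b t0 : R) (f g : R -> X) :
  morse_path d D A B f -> A <= s <= B -> A <= t <= B ->
  1 <= l -> 0 <= c -> qgeod d l c a b g -> g a = f s -> nearest (f t) a b g t0 ->
  let E := D (3 * l) (c + l * (5 * C0 + 2)) in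
  (forall w, a <= w <= t0 -> exists2 v, between s t v & d (f v) (g w) <= E) /\
  (forall v, between s t v -> exists2 w, a <= w <= b &
     d (f v) (g w) <= E + d (g t0) (f t) + 2 * C0).
Proof.
move=> mf sAB tAB l1 c0 qg gs near E; have C00 := C0_ge0.
have [m [z [m0 qz z0 zm]]] := dG (g t0) (f t).
rewrite -zm in near; have t0ab := near.1.
have qh := qgeod_detour l1 c0 m0 near qg qz z0.
set h := glue _ _ _ in qh.
have gz : g t0 = z (t0 - t0) by rewrite subrr z0.
have ha : h a = f s by rewrite /h glue_le //; lra.
have hb : h (t0 + m) = f t.
  by rewrite /h (glue_ge (g := fun t => z (t - t0)) gz) ?lerDl // [t0 + m]addrC
    addrK.
have lC : 0 <= l * (5 * C0 + 2) by apply: mulr_ge0; lra.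
have [|||H1 H2] := mf _ _ _ _ s t sAB tAB a (t0 + m) h _ qh ha hb; [lra..|].
split=> [w wat|v /H1[w wab dw]].
  have [|v vst dv] := H2 w; first by lra.
  by exists v => //; move: dv; rewrite /h glue_le //; lra.
have d0 := pm_ge0 dP (g t0) (f t).
case: (leP w t0) => wt.
  exists w; first by lra.
  by move: dw; rewrite /h glue_le // -/E; lra.
exists t0 => //.
move: dw; rewrite /h (glue_ge (g := fun t => z (t - t0)) gz (ltW wt)) -/E => dw.
have := pm_tri dP (f v) (z (w - t0)) (g t0).
have [q1 _] := qz (w - t0) 0 ltac:(lra) ltac:(lra).
have [_ q2] := qz 0 m ltac:(lra) ltac:(lra).
move: q1 q2; rewrite z0 zm subr0 sub0r normrN !mul1r !ger0_norm //; last by lra.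
lra.
Qed.

Section TwoPieces.
Context (D : R -> R -> R) (F : R -> R).

Definition no_fellow (a m b : R) (f g : R -> X) : Prop :=
  forall r s t, a <= s <= m -> m <= t <= b -> d (f s) (g t) <= r ->
    d (f s) (f m) <= F r.

(** Both Morse paths pass within [E] of the point nearest to the junction, hence within [2 * E] of
    each other, and [F (2 * E) + E] bounds the distance from that point to the junction; the rest is
    the cost of [morse_nearest]. *)
Definition thin_const (l c : R) : R :=
  let E := D (3 * l) (c + l * (5 * C0 + 2)) in F (2 * E) + 2 * E + 2 * C0.

(* The point [h t0] nearest to the junction cuts [h] into two pieces, each of
   which becomes a quasigeodesic between points of one of the two Morse paths
   once completed by a geodesic to the junction. So [h t0] is close to both
   paths, hence to the junction. *)
Lemma two_pieces_thin (a m b s t l c a' b' : R) (f g h : R -> X) :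
  morse_path d D a m f -> morse_path d D m b g -> f m = g m ->
  no_fellow a m b f g -> a <= s <= m -> m <= t <= b -> a' <= b' ->
  1 <= l -> 0 <= c -> qgeod d l c a' b' h -> h a' = f s -> h b' = g t ->
  (exists2 t0, a' <= t0 <= b' & d (h t0) (f m) <= thin_const l c) /\
  fellow d (thin_const l c) (glue m f g) s t h a' b'.
Proof.
move=> mf mg fg nf sam tmb ab l1 c0 qh hs ht; have C00 := C0_ge0.
have [t0 near] := nearest_exists (f m) h ab.
have t0ab := near.1.
have [||H1 H2] := morse_nearest (s := s) (t := m) mf _ _ l1 c0 qh hs near; [lra..|].
have hrev : h (a' + b' - a') = g t by rewrite [a' + b']addrC addrK.
rewrite fg in near.
have [||H3 H4] := morse_nearest (s := t) (t := m) mg _ _ l1 c0 (rev_qgeod qh) hrev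
  (nearest_rev near); [lra..|].
rewrite /thin_const; set E := D _ _ in H1 H2 H3 H4 *.
have [v vsm dv] := H1 t0 ltac:(lra).
have [v' vtm dv'] := H3 (a' + b' - t0) ltac:(lra).
have t0E : a' + b' - (a' + b' - t0) = t0 by ring.
rewrite t0E in dv' H4.
have T := pm_tri dP (f v) (h t0) (g v').
rewrite [d (h t0) (g v')](pm_sym dP) in T.
have vE : a <= v <= m by case: vsm; lra.
have v'E : m <= v' <= b by case: vtm; lra.
have nv := nf (2 * E) v v' vE v'E ltac:(lra).
have T' := pm_tri dP (h t0) (f v) (f m).
rewrite [d (h t0) (f v)](pm_sym dP) in T'.
have d0 := pm_ge0 dP (h t0) (f m); have dv0 := pm_ge0 dP (f v) (h t0).
have nF := pm_ge0 dP (f v) (f m).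
split; first by exists t0 => //; lra.
split=> [u ust|w wab].
  have sut : s <= u <= t by case: ust; lra.
  case: (leP u m) => um.
    have [|w wab dw] := H2 u; first by left; lra.
    by exists w => //; rewrite glue_le //; lra.
  have [|w wab dw] := H4 u; first by right; lra.
  exists (a' + b' - w); first by lra.
  rewrite (glue_ge fg (ltW um)); rewrite -fg in dw; lra.
case: (leP w t0) => wt.
  have [|u usm du] := H1 w; first by lra.
  exists u; first by left; case: usm; lra.
  by rewrite glue_le; [lra|case: usm; lra].
have [|u usm du] := H3 (a' + b' - w); first by lra.
exists u; first by left; case: usm; lra.
rewrite (glue_ge fg); last by case: usm; lra.
have wE : a' + b' - (a' + b' - w) = w by ring.
by rewrite wE in du; lra.
Qed.

Context (C : R) (C_ge0 : 0 <= C).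

Definition glue_qi_const : R := Num.max C (2 * C + 3 * C0 + 2 * thin_const 1 C0).
Definition glue_morse (l c : R) : R := Num.max (D l c) (thin_const l c).

(** A coarse geodesic from [f s] to [g t] passes near the junction, so the two pieces are together
    not much longer than it; this is the second term of [glue_qi_const]. The Morse bound is
    [thin_const] across the junction and [D] on either side. *)
Lemma two_pieces (a m b : R) (f g : R -> X) :
  a <= m -> m <= b ->
  qgeod d 1 C a m f -> qgeod d 1 C m b g ->
  morse_path d D a m f -> morse_path d D m b g -> f m = g m ->
  no_fellow a m b f g ->
  qgeod d 1 glue_qi_const a b (glue m f g) /\
  morse_path d glue_morse a b (glue m f g).
Proof.
move=> am mb qf qg mf mg fg nf; have [C00 C01] := (C0_ge0, C_ge0); split.
  have CC : C <= glue_qi_const by rewrite le_max lexx.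
  apply: qgeod_glue => //.
  - by apply: qgeod_weaken qf; rewrite ?ler01.
  - by apply: qgeod_weaken qg; rewrite ?ler01.
  move=> s t sam tmb.
  have [n [z [n0 qz z0 zn]]] := dG (f s) (g t).
  have [[t0 t0n dt0] _] := two_pieces_thin mf mg fg nf sam tmb n0 (lexx 1) C0_ge0
    qz z0 zn.
  have := le_max (2 * C + 3 * C0 + 2 * thin_const 1 C0) C (2 * C + 3 * C0 + 2 *
    thin_const 1 C0).
  rewrite lexx orbT -/glue_qi_const => K.
  have [qf1 qf2] := qf s m ltac:(lra) ltac:(lra).
  have [qg1 qg2] := qg m t ltac:(lra) ltac:(lra).
  have [qz1 _] := qz 0 n ltac:(lra) ltac:(lra).
  have [_ qz2] := qz 0 n ltac:(lra) ltac:(lra).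
  have [qz3 _] := qz 0 t0 ltac:(lra) ltac:(lra).
  have [qz4 _] := qz t0 n ltac:(lra) ltac:(lra).
  move: qf1 qf2 qg1 qg2 qz1 qz2 qz3 qz4.
  rewrite !mul1r !sub0r !normrN z0 zn -fg.
  rewrite [`|s - m|]distrC [`|m - t|]distrC [`|t0 - n|]distrC.
  rewrite [`|m - s|]ger0_norm ?[`|t - m|]ger0_norm ?[`|n|]ger0_norm
    ?[`|t0|]ger0_norm ?[`|n - t0|]ger0_norm //; [|lra..].
  move=> qf1 qf2 qg1 qg2 qz1 qz2 qz3 qz4.
  have T1 := pm_tri dP (f s) (f m) (g t).
  have T2 := pm_tri dP (f s) (z t0) (f m).
  have T3 := pm_tri dP (f m) (z t0) (g t).
  rewrite [d (f m) (z t0)](pm_sym dP) in T3.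
  split; lra.
apply: morse_path_ordered => l c l1 c0 s t as_ st tb a' b' h ab qh hs ht.
have E1 : D l c <= glue_morse l c by rewrite le_max lexx.
have E2 : thin_const l c <= glue_morse l c by rewrite le_max lexx orbT.
case: (leP t m) => tm.
  rewrite (glue_le _ _ tm) (glue_le _ _ (le_trans st tm)) in hs ht.
  apply: fellow_le E1 _.
  have [||H1 H2] := mf l c l1 c0 s t _ _ a' b' h ab qh hs ht; [lra..|].
  split=> [v vst|w /H2[v vst]]; first by rewrite glue_le; [exact: H1|case: vst;
    lra].
  by exists v => //; rewrite glue_le //; case: vst; lra.
case: (leP s m) => sm.
  rewrite (glue_le _ _ sm) (glue_ge fg (ltW tm)) in hs ht.
  apply: fellow_le E2 _.
  by have [||_] := two_pieces_thin (s := s) (t :=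
    t) mf mg fg nf _ _ ab l1 c0 qh hs ht; [lra..|].
rewrite (glue_ge fg (ltW sm)) (glue_ge fg (ltW tm)) in hs ht.
apply: fellow_le E1 _.
have [||H1 H2] := mg l c l1 c0 s t _ _ a' b' h ab qh hs ht; [lra..|].
split=> [v vst|w /H2[v vst]].
  by rewrite (glue_ge fg); [exact: H1|case: vst; lra].
by exists v => //; rewrite (glue_ge fg) //; case: vst; lra.
Qed.

End TwoPieces.

(** A quasigeodesic with endpoints on [z] has endpoints within [r] of [f], as [z] itself follows
    [f]. Both it and the stretch of [z] between them then follow the same stretch of [f]. *)
Lemma morse_straighten (D : R -> R -> R) (r0 : R) : 0 <= r0 ->
  exists (D' : R -> R -> R) (r : R),
  forall a b m f z, a <= b -> 0 <= m -> morse_path d D a b f ->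
    qgeod d 1 C0 0 m z -> d (z 0) (f a) <= r0 -> d (z m) (f b) <= r0 ->
    morse_path d D' 0 m z /\
    forall t, 0 <= t <= m -> exists2 s, a <= s <= b & d (z t) (f s) <= r.
Proof.
move=> r0_ge0; pose r := D 1 (C0 + 2 * 1 * r0 + 2) + r0.
pose D' l c := (D l (c + 2 * l * r + 2) + r) + (D 1 (C0 + 2 * 1 * r + 2) + r).
exists D', r => a b m f z ab m0 mf qz za zb.
have [||_ Hz] := morse_coarse dP mf (lexx 1) C0_ge0 r0_ge0
  (s := a) (t := b) _ _ m0 qz za zb; [lra..|].
have near t : 0 <= t <= m -> exists2 s, a <= s <= b & d (z t) (f s) <= r.
  move=> /Hz[s sab ds]; exists s; first by case: sab; lra.
  by rewrite (pm_sym dP).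
split=> //; apply: morse_path_ordered => l c l1 c0 s t s0 st tm a' b' g ab' qg gs
  gt.
have [s1 s1ab ds] := near s ltac:(lra).
have [t1 t1ab dt] := near t ltac:(lra).
have r0' : 0 <= r by have := pm_ge0 dP (z s) (f s1); lra.
rewrite -gs in ds; rewrite -gt in dt.
have [G1 G2] := morse_coarse dP mf l1 c0 r0' s1ab t1ab ab' qg ds dt.
rewrite gs in ds; rewrite gt in dt.
have [Z1 Z2] := morse_coarse dP mf (lexx 1) C0_ge0 r0' s1ab t1ab st (sub_qgeod s0
  tm qz) ds dt.
split=> [v vst|w wab].
  have [|u u1 du] := Z2 v; first by case: vst; lra.
  have [w w1 dw] := G1 u u1.
  exists w => //; have := pm_tri dP (z v) (f u) (g w).
  by rewrite [d (z v) (f u)](pm_sym dP) /D'; lra.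
have [u u1 du] := G2 w wab.
have [v v1 dv] := Z1 u u1.
exists v; first by left.
have := pm_tri dP (z v) (f u) (g w).
by rewrite [d (z v) (f u)](pm_sym dP) /D'; lra.
Qed.

End Glue.

(** * Stable subgroups for a word metric *)

Lemma seq_directed (T : eqType) (B : Type) (le : B -> B -> Prop) (b0 : B)
    (P : T -> B -> Prop) (s : seq T) :
  (forall x y, exists z, le x z /\ le y z) ->
  (forall t x y, t \in s -> le x y -> P t x -> P t y) ->
  (forall t, t \in s -> exists b, P t b) ->
  exists b, forall t, t \in s -> P t b.
Proof.
move=> dir; elim: s => [_ _|t s IH mono ex]; first by exists b0.
have [b Pb] : exists b, forall t, t \in s -> P t b.
  apply: IH => [u x y us|u us]; first by apply: mono; rewrite inE us orbT.
  by apply: ex; rewrite inE us orbT.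
have [c Pc] := ex t (mem_head _ _).
have [z [bz cz]] := dir b c.
exists z => u; rewrite inE => /orP[/eqP ->|us].
  by apply: mono cz Pc; exact: mem_head.
by apply: mono bz (Pb u us); rewrite inE us orbT.
Qed.

Lemma finite_bounded (T : eqType) (A : set T) (P : T -> nat -> Prop) :
  finite_set A -> (forall t m n, (m <= n)%N -> P t m -> P t n) ->
  (forall t, A t -> exists n, P t n) -> exists n, forall t, A t -> P t n.
Proof.
move=> /finite_seqP[s ->] mono ex.
have [x y|t m n _|t|n Pn] := @seq_directed _ _ (fun m n => (m <= n)%N) 0%N P s.
- by exists (maxn x y); rewrite leq_maxl leq_maxr.
- exact: mono.
- exact: ex.
- by exists n.
Qed.

Section Subgroups.
Context (G : groupType).
Implicit Types (H K : set G) (x y : G).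

Lemma subgroup_intro H : H 1%g -> (forall x y, H x -> H y -> H (x * y)%g) ->
  (forall x, H x -> H x^-1%g) -> is_subgroup H.
Proof.
move=> H1 HM HV; split=> [|x y]; rewrite !inE // => Hx Hy.
by apply: HM => //; exact: HV.
Qed.

Lemma subgroup1 H : is_subgroup H -> H 1%g.
Proof. by case; rewrite inE. Qed.

Lemma subgroupM H x y : is_subgroup H -> H x -> H y -> H (x * y)%g.
Proof. by move=> /group_closedM/(_ x y); rewrite !inE => + Hx Hy; exact. Qed.

Lemma subgroupV H x : is_subgroup H -> H x -> H x^-1%g.
Proof. by move=> /group_closedV/(_ x); rewrite !inE => + Hx; exact. Qed.

Definition conjugate (u : G) H : set G := [set x | H (u^-1 * x * u)%g].

Lemma conjugate_subgroup u H : is_subgroup H -> is_subgroup (conjugate u H).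
Proof.
move=> sH; apply: subgroup_intro; rewrite /conjugate /=.
- by rewrite mulg1 mulVg; exact: subgroup1.
- move=> x y Hx Hy; have := subgroupM sH Hx Hy.
  by rewrite !mulgA mulgK.
- by move=> x Hx; have := subgroupV sH Hx; rewrite !invgM invgK mulgA.
Qed.

End Subgroups.

(** Everything up to the Cayley graph rests on these properties alone. The map [w] in [wl_geod]
    lists the vertices of a geodesic from [1] to [x]. *)
Record word_length (G : groupType) (wl : G -> nat) : Prop := WordLength {
  wl1 : wl 1%g = 0%N;
  wlV : forall x, wl x^-1%g = wl x;
  wlM : forall x y, (wl (x * y)%g <= wl x + wl y)%N;
  wl_ball : forall n, finite_set [set x | (wl x <= n)%N];
  wl_geod : forall x, exists w : nat -> G, [/\ w 0%N = 1%g, w (wl x) = x &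
    forall i j, (i <= j)%N -> (j <= wl x)%N -> wl ((w i)^-1 * w j)%g = (j - i)%N]
}.

Definition wdist (R : realType) (G : groupType) (wl : G -> nat) (x y : G) : R :=
  (wl (x^-1 * y)%g)%:R.

Section WordMetric.
Context (R : realType) (G : groupType) (wl : G -> nat) (wlP : word_length wl).
Implicit Types (H K : set G) (x y : G).

Local Notation d := (@wdist R G wl).

Lemma wdist_pseudometric : pseudometric d.
Proof.
split=> [x|x y|x y z]; rewrite /wdist.
- by rewrite mulVg (wl1 wlP).
- by rewrite -(wlV wlP) invgM invgK.
- rewrite -natrD ler_nat.
  by have := wlM wlP (x^-1 * y)%g (y^-1 * z)%g; rewrite -mulgA mulVKg.
Qed.

Lemma wdist_translate u x y : d (u * x)%g (u * y)%g = d x y.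
Proof. by rewrite /wdist invgM -mulgA mulKg. Qed.

Lemma wdist1 x : d 1%g x = (wl x)%:R.
Proof. by rewrite /wdist invg1 mul1g. Qed.

Lemma wdist_coarsely_geodesic : coarsely_geodesic d 1.
Proof.
move=> x y; have [w [w0 wn wd]] := wl_geod wlP (x^-1 * y)%g.
set n := wl _ in wn wd.
exists n%:R, (fun t => x * w (Num.truncn t))%g; split.
- exact: ler0n.
- suff H s t : 0 <= s -> s <= t -> t <= n%:R ->
      d (x * w (Num.truncn s))%g (x * w (Num.truncn t))%g <= (t - s) + 1 /\
      t - s <= d (x * w (Num.truncn s))%g (x * w (Num.truncn t))%g + 1.
    move=> s t sn tn; rewrite !mul1r.
    have [st|/ltW ts] := leP s t.
      by rewrite distrC ger0_norm; [apply: H; lra|lra].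
    by rewrite ger0_norm 1?(pm_sym wdist_pseudometric (_ * w (Num.truncn s))%g);
      [apply: H; lra|lra].
  move=> s0 st tn.
  have := truncn_itv s0; have := truncn_itv (le_trans s0 st).
  have tsn := le_truncn st.
  have tnn : (Num.truncn t <= n)%N.
    by rewrite -(ler_nat R); have := truncn_le t; rewrite (le_trans s0 st); lra.
  rewrite wdist_translate /wdist wd // natrB // -!natr1; lra.
- by rewrite truncn0 w0 mulg1.
- by rewrite natrK wn mulVKg.
Qed.

Lemma translate_qgeod u l c a b (f : R -> G) :
  qgeod d l c a b f -> qgeod d l c a b (fun t => u * f t)%g.
Proof. by move=> qf s t sab tab; rewrite wdist_translate; exact: qf. Qed.

Lemma translate_morse_path u D a b (f : R -> G) :
  morse_path d D a b f -> morse_path d D a b (fun t => u * f t)%g.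
Proof.
move=> mf l c l1 c0 s t sab tab a' b' g ab qg gs gt.
have [||H1 H2] := mf l c l1 c0 s t sab tab a' b' (fun t => u^-1 * g t)%g ab
  (translate_qgeod u^-1%g qg); rewrite ?gs ?gt ?mulKg //.
split=> [v /H1[w wab dw]|w /H2[v vst dv]].
  by exists w => //; rewrite -(wdist_translate u^-1%g) mulKg.
by exists v => //; rewrite -(wdist_translate u^-1%g) mulKg.
Qed.

(* The additive constant [1] leaves room for rounding parameters to integers. *)
Definition leash (D : R -> R -> R) (mu : R) H h (b : R) (f : R -> G) : Prop :=
  [/\ 0 <= b, f 0 = 1%g /\ f b = h, qgeod d 1 1 0 b f, morse_path d D 0 b f &
    forall t, 0 <= t <= b -> exists2 k, H k & d (f t) k <= mu].

Definition dstable_with (D : R -> R -> R) (mu : R) H : Prop :=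
  is_subgroup H /\ forall h, H h -> exists b f, leash D mu H h b f.

(* Discrete counterpart of [stable], with paths running through vertices. *)
Definition dstable H : Prop := exists D mu, dstable_with D mu H.

Lemma dstable_subgroup H : dstable H -> is_subgroup H.
Proof. by move=> [D [mu []]]. Qed.

(** The given path may have poor quasigeodesic constants and miss the exact endpoints:
    [morse_straighten] replaces it by a coarse geodesic from [1] to [h], as [leash] requires. *)
Lemma dstable_intro D mu r H : is_subgroup H ->
  (forall h, H h -> exists a b f, [/\ a <= b, d 1%g (f a) <= r, d h (f b) <= r,
     morse_path d D a b f &
     forall t, a <= t <= b -> exists2 k, H k & d (f t) k <= mu]) -> dstable H.
Proof.
move=> sH Hpath.
have r0 : 0 <= r.
  have [a [b [f [_ H1 _ _ _]]]] := Hpath _ (subgroup1 sH).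
  by have := pm_ge0 wdist_pseudometric 1%g (f a); lra.
have [D' [r' HD]] := morse_straighten wdist_pseudometric ler01 D r0.
exists D', (r' + mu); split=> // h /Hpath[a [b [f [ab fa fb mf fH]]]].
have [m [z [m0 qz z0 zm]]] := wdist_coarsely_geodesic 1%g h.
rewrite -z0 in fa; rewrite -zm in fb.
have [mz zf] := HD _ _ _ _ _ ab m0 mf qz fa fb.
exists m, z; split=> // t /zf[s sab ds].
have [k Hk dk] := fH s sab.
by exists k => //; have := pm_tri wdist_pseudometric (z t) (f s) k; lra.
Qed.

Definition gauge_le (p q : (R -> R -> R) * R) : Prop :=
  (forall l c, p.1 l c <= q.1 l c) /\ p.2 <= q.2.

Lemma gauge_dir p q : exists r, gauge_le p r /\ gauge_le q r.
Proof.
exists (fun l c => Num.max (p.1 l c) (q.1 l c), Num.max p.2 q.2).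
by split; split=> [l c|]; rewrite /= le_max lexx ?orbT.
Qed.

Lemma morse_path_le D D' a b (f : R -> G) :
  (forall l c, D l c <= D' l c) -> morse_path d D a b f -> morse_path d D' a b f.
Proof.
move=> DD mf l c l1 c0 s t sab tab a' b' g ab qg gs gt.
by apply: fellow_le (DD l c) _; exact: mf.
Qed.

Lemma leash_le p q H h b f :
  gauge_le p q -> leash p.1 p.2 H h b f -> leash q.1 q.2 H h b f.
Proof.
move=> [pq1 pq2] [b0 fh qf mf fH]; split=> //; first exact: morse_path_le mf.
by move=> t /fH[k Hk dk]; exists k => //; lra.
Qed.

Lemma dstable_with_le p q H : gauge_le p q -> dstable_with p.1 p.2 H ->
  dstable_with q.1 q.2 H.
Proof.
move=> pq [sH lH]; split=> // h /lH[b [f lf]].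
by exists b, f; exact: leash_le lf.
Qed.

Lemma dstable_uniform (s : seq (set G)) : (forall H, H \in s -> dstable H) ->
  exists D mu, forall H, H \in s -> dstable_with D mu H.
Proof.
move=> sS.
have [|H p q _|H /sS[D [mu]]|[D mu] sD] := @seq_directed _ _ gauge_le
  (fun _ _ => 0, 0) (fun H p => dstable_with p.1 p.2 H) s.
- exact: gauge_dir.
- exact: dstable_with_le.
- by exists (D, mu).
- by exists D, mu.
Qed.

(** Left translation by [u] sends a path near [H] to one near the coset [u H], and right
    multiplication by [u^-1] moves that coset onto the conjugate over a distance [wl u]. *)
Lemma dstable_conjugate u H : dstable H -> dstable (conjugate u H).
Proof.
move=> [D [mu [sH lH]]].
apply: (@dstable_intro D (mu + (wl u)%:R) (wl u)%:R).
  exact: conjugate_subgroup.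
move=> x; rewrite /conjugate /= => /lH[b [f [b0 [f0 fb] qf mf fH]]].
exists 0, b, (fun t => u * f t)%g; split=> //.
- by rewrite f0 mulg1 wdist1.
- by rewrite fb /wdist -!mulgA mulVKg mulKg.
- exact: translate_morse_path.
- move=> t /fH[k Hk dk]; exists (u * k * u^-1)%g.
    by rewrite -!mulgA mulKg mulVg mulg1.
  have := pm_tri wdist_pseudometric (u * f t)%g (u * k)%g (u * k * u^-1)%g.
  rewrite wdist_translate {3}/wdist mulKg (wlV wlP); lra.
Qed.

Lemma wl_bound (r : R) x : (wl x)%:R <= r -> (wl x <= Num.truncn r)%N.
Proof.
by move=> xr; rewrite truncn_ge_nat //; apply: le_trans xr; exact: ler0n.
Qed.

(* Pigeonhole: there are finitely many differences of length at most [r]. *)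
Lemma bounded_representatives H K (r : R) : exists M : nat, forall a k,
  H a -> K k -> (wl (a^-1 * k)%g)%:R <= r -> exists a' k',
  [/\ H a', K k', (a'^-1 * k')%g = (a^-1 * k)%g, (wl a' <= M)%N & (wl k' <= M)%N].
Proof.
have [||n nP] := @finite_bounded G [set x | (wl x <= Num.truncn r)%N]
  (fun x n => forall a k, H a -> K k -> (a^-1 * k)%g = x -> exists a' k',
  [/\ H a', K k', (a'^-1 * k')%g = x, (wl a' <= n)%N & (wl k' <= n)%N])
  (wl_ball wlP _).
- move=> x m n mn Hm a k Ha Kk akx.
  have [a' [k' [? ? ? am km]]] := Hm a k Ha Kk akx.
  by exists a', k'; split=> //; apply: leq_trans mn.
- move=> x _.
  have [[a [k [Ha Kk akx]]]|nex] := pselect (exists a k, [/\ H a,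
    K k & (a^-1 * k)%g = x]).
    exists (maxn (wl a) (wl k)) => _ _ _ _ _; exists a, k.
    by rewrite leq_maxl leq_maxr.
  by exists 0%N => a k Ha Kk akx; exfalso; apply: nex; exists a, k.
- exists n => a k Ha Kk /wl_bound akr.
  exact: (nP _ akr a k).
Qed.

(** The leash of [x] in [K] joins the ends of its leash in [H], so the two stay close. Nearby [h] in
    [H] and [k] in [K] have a bounded difference; dividing each by a short element with the same
    difference gives one element of both groups. *)
Lemma dstable_setI H K : dstable H -> dstable K -> dstable (H `&` K).
Proof.
move=> [D [mu [sH lH]]] [D' [mu' [sK lK]]].
pose E := D 1 1.
have [M MP] := bounded_representatives H K (mu + E + mu').
apply: (@dstable_intro D (mu + M%:R) 0); first exact: is_subgroupI.
move=> x [Hx Kx].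
have [b [f [b0 [f0 fb] qf mf fH]]] := lH x Hx.
have [b' [g [b0' [g0 gb] qg mg gK]]] := lK x Kx.
have dP := wdist_pseudometric.
exists 0, b, f; split=> //; rewrite ?f0 ?fb ?(pmxx dP) //.
move=> t tb.
have [||||F1 _] := mf 1 1 (lexx _) ler01 0 b _ _ 0 b' g b0' qg;
  rewrite ?lexx ?b0 ?f0 ?fb //.
have [|w wb dw] := F1 t; first by left.
have [h Hh dh] := fH t tb; have [k Kk dk] := gK w wb.
have hk : d h k <= mu + E + mu'.
  have := pm_tri dP h (f t) k; have := pm_tri dP (f t) (g w) k.
  by rewrite [d h (f t)](pm_sym dP) -/E in dw *; lra.
have [a [k' [Ha Kk' ak aM kM]]] := MP h k Hh Kk hk.
exists (h * a^-1)%g.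
  split; first by apply: subgroupM => //; exact: subgroupV.
  have -> : (h * a^-1 = k * k'^-1)%g.
    by apply: (mulgI h^-1%g); rewrite mulKg mulgA -ak mulgK.
  by apply: subgroupM => //; exact: subgroupV.
have := pm_tri dP (f t) h (h * a^-1)%g.
rewrite {3}/wdist mulKg (wlV wlP).
have : (wl a)%:R <= M%:R :> R by rewrite ler_nat.
lra.
Qed.

End WordMetric.

Section Generated.
Context (G : groupType).
Implicit Types (S K : set G) (x y : G).

Lemma sub_generated S : S `<=` generated S.
Proof. by move=> x Sx K [_]; exact. Qed.

Lemma generated_min S K : is_subgroup K -> S `<=` K -> generated S `<=` K.
Proof. by move=> sK SK x; apply. Qed.

Lemma generated_subgroup S : is_subgroup (generated S).
Proof.
apply: subgroup_intro => [|x y Sx Sy|x Sx] K KS.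
- exact: subgroup1 KS.1.
- by apply: (subgroupM KS.1); [exact: Sx|exact: Sy].
- by apply: (subgroupV KS.1); exact: Sx.
Qed.

End Generated.

Section StableSubgroups.
Context (R : realType) (G : groupType) (wl : G -> nat) (wlP : word_length wl).
Implicit Types (H K : set G) (x y : G).

Local Notation d := (@wdist R G wl).
Local Notation leash := (@leash R G wl).
Local Notation dstable_with := (@dstable_with R G wl).
Local Notation dstable := (@dstable R G wl).

Let dP := wdist_pseudometric R wlP.
Let dG := wdist_coarsely_geodesic R wlP.

(** Sampling a leash at times at most one apart gives elements of [H] whose successive quotients
    have length at most [2 * mu + 2]; these short elements generate. *)
Lemma dstable_finitely_generated H : dstable H -> finitely_generated H.
Proof.
move=> [D [mu [sH lH]]].
pose S := [set h | H h /\ (wl h <= Num.truncn (2 * mu + 2))%N].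
exists S.
  by apply: sub_finite_set (wl_ball wlP (Num.truncn (2 * mu + 2))) => x [].
apply/seteqP; split; last first.
  by apply: generated_min => // x [].
move=> h Hh; have [b [f [b0 [f0 fb] qf _ fH]]] := lH h Hh.
have mu0 : 0 <= mu.
  have [|k _ dk] := fH 0; first by rewrite lexx.
  by have := pm_ge0 dP (f 0) k; lra.
have SS := sub_generated (S := S).
suff near n t k : 0 <= t <= b -> t <= n%:R -> H k -> d (f t) k <= mu ->
  generated S k.
  apply: (near (Num.truncn b).+1 b h) => //; rewrite ?b0 ?lexx ?fb ?(pmxx dP) //.
  by have /andP[_ /ltW] := truncn_itv b0.
elim: n t k => [|n IH] t k tb tn Hk dk.
  have t0 : t = 0 by lra.
  apply: SS; split=> //; apply: (@wl_bound R).
  by move: dk; rewrite t0 f0 wdist1; lra.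
pose t' := if t < 1 then 0 else t - 1.
have t'b : 0 <= t' <= b /\ t' <= n%:R.
  by rewrite /t'; rewrite -natr1 in tn; case: ltP => t1; have := ler0n R n; lra.
have t't : 0 <= t - t' <= 1 by rewrite /t'; case: ltP => t1; lra.
have [k' Hk' dk'] := fH t' t'b.1.
have gk' := IH t' k' t'b.1 t'b.2 Hk' dk'.
rewrite -(mulVKg k' k); apply: (subgroupM (generated_subgroup S) gk').
apply: SS; split; first by apply: subgroupM => //; exact: subgroupV.
apply: (@wl_bound R).
have [q _] := qf t' t t'b.1 tb.
rewrite distrC ger0_norm ?mul1r in q; last by lra.
have T1 := pm_tri dP k' (f t') k; have T2 := pm_tri dP (f t') (f t) k.
rewrite [d k' (f t')](pm_sym dP) in T1.
by rewrite -/(d k' k); lra.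
Qed.

(** Passing [z] across the corner leaves [p * q] unchanged; the corner is minimal when no such move
    shortens the two letters in total. *)
Definition adjmin H p K q : Prop :=
  forall z, H z -> K z -> (wl p + wl q <= wl (p * z) + wl (z^-1 * q))%N.

(* If the paths came close again far from their common endpoint, the pigeonhole
   principle would give [z] shortening both [p] and [q]. *)
Lemma adjmin_no_fellow D mu H K : is_subgroup H -> is_subgroup K ->
  exists F : R -> R, forall p q b f b' g, H p -> K q -> adjmin H p K q ->
    leash D mu H p b f -> leash D mu K q b' g ->
    no_fellow d F 0 b (b + b') f (fun t => p * g (t - b))%g.
Proof.
move=> sH sK.
have [M MP] := choice (bounded_representatives (R := R) wlP H K).
(* One unit comes from each of the five inequalities [q1] to [q5], one [mu] from each of [h] and
   [k], and the representatives [a'] and [k'] have length at most [M (r + 2 * mu)]. *)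
exists (fun r => 5 + 2 * mu + 2 * (M (r + 2 * mu))%:R).
move=> p q b f b' g Hp Kq pq [b0 [f0 fb] qf _ fH] [b'0 [g0 gb] qg _ gK] r s t sb
  tb dst.
set t' := t - b in dst *.
have t'b : 0 <= t' <= b' by rewrite /t'; lra.
have [h Hh dh] := fH s sb; have [k Kk dk] := gK t' t'b.
pose a := (p^-1 * h)%g.
have Ha : H a by apply: subgroupM => //; exact: subgroupV.
have ha : h = (p * a)%g by rewrite /a mulVKg.
have ak : (wl (a^-1 * k)%g)%:R <= r + 2 * mu.
  rewrite -/(d a k) -(wdist_translate R wl p) -ha.
  have := pm_tri dP h (f s) (p * k)%g.
  have := pm_tri dP (f s) (p * g t')%g (p * k)%g.
  rewrite wdist_translate [d h (f s)](pm_sym dP); lra.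
have [a' [k' [Ha' Kk' ak' aM kM]]] := MP _ a k Ha Kk ak.
set m := M _ in aM kM *.
pose z := (a * a'^-1)%g.
have zk : z = (k * k'^-1)%g.
  by apply: (mulgI a^-1%g); rewrite /z mulKg mulgA -ak' mulgK.
have Hz : H z by apply: subgroupM => //; exact: subgroupV.
have Kz : K z by rewrite zk; apply: subgroupM => //; exact: subgroupV.
have := pq z Hz Kz.
have -> : (p * z = h * a'^-1)%g by rewrite /z mulgA -ha.
have -> : (z^-1 * q = k' * (k^-1 * q))%g by rewrite zk invgM invgK mulgA.
have W1 := wlM wlP h a'^-1%g; have W2 := wlM wlP k' (k^-1 * q)%g.
rewrite (wlV wlP) in W1 => W3.
have W : (wl p + wl q <= wl h + wl (k^-1 * q)%g + m + m)%N by lia.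
move: W; rewrite -(ler_nat R) !natrD -/(d k q) -!(wdist1 R).
have [_ q1] := qf 0 b ltac:(lra) ltac:(lra).
have [q2 _] := qf 0 s ltac:(lra) ltac:(lra).
have [q3 _] := qf s b ltac:(lra) ltac:(lra).
have [_ q4] := qg 0 b' ltac:(lra) ltac:(lra).
have [q5 _] := qg t' b' ltac:(lra) ltac:(lra).
move: q1 q2 q3 q4 q5; rewrite !mul1r !sub0r !normrN f0 fb g0 gb.
rewrite [`|s - b|]distrC [`|t' - b'|]distrC !ger0_norm; [|lra..].
move=> q1 q2 q3 q4 q5.
have T1 := pm_tri dP 1%g (f s) h; have T2 := pm_tri dP k (g t') q.
rewrite [d k (g t')](pm_sym dP) in T2.
lra.
Qed.

End StableSubgroups.

(** * Chains of Morse geodesics *)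

Definition gprod (G : groupType) (s : seq G) : G :=
  foldr (fun x y => x * y)%g 1%g s.

Section Chains.
Context (R : realType) (G : groupType) (wl : G -> nat) (wlP : word_length wl).
Implicit Types (H K : set G).

Local Notation d := (@wdist R G wl).
Local Notation leash := (@leash R G wl).
Local Notation dstable_with := (@dstable_with R G wl).
Local Notation dstable := (@dstable R G wl).

Let dP := wdist_pseudometric R wlP.
Let dG := wdist_coarsely_geodesic R wlP.

Lemma no_fellow_le F F' a m b (f g : R -> G) : (forall r, F r <= F' r) ->
  no_fellow d F a m b f g -> no_fellow d F' a m b f g.
Proof.
by move=> FF nf r s t sam tmb dst; apply: le_trans (FF r); exact: nf dst.
Qed.

Lemma no_fellow_uniform D mu (s : seq (set G)) :
  (forall H, H \in s -> is_subgroup H) ->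
  exists F : R -> R, forall H K p q b f b' g, H \in s -> K \in s -> H p -> K q ->
    adjmin wl H p K q -> leash D mu H p b f -> leash D mu K q b' g ->
    no_fellow d F 0 b (b + b') f (fun t => p * g (t - b))%g.
Proof.
move=> sS.
pose P (HK : set G * set G) (F : R -> R) := forall p q b f b' g, HK.1 p -> HK.2 q ->
    adjmin wl HK.1 p HK.2 q -> leash D mu HK.1 p b f -> leash D mu HK.2 q b' g ->
    no_fellow d F 0 b (b + b') f (fun t => p * g (t - b))%g.
have [F1 F2|HK F1 F2 _ F12 PF|HK|F PF] := @seq_directed _ _
  (fun F F' : R -> R => forall r, F r <= F' r) (fun=> 0) P [seq (H, K) | H <- s,
    K <- s].
- exists (fun r => Num.max (F1 r) (F2 r)).
  by split=> r; rewrite le_max lexx ?orbT.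
- move=> p q b f b' g Hp Kq pq lf lg; apply: no_fellow_le F12 _.
  exact: (PF p q b f b' g).
- move=> /allpairsP[[H K] /= [Hs Ks ->]].
  exact: adjmin_no_fellow (sS H Hs) (sS K Ks).
- exists F => H K p q b f b' g Hs Ks.
  by apply: (PF (H, K)); apply/allpairsP; exists (H, K).
Qed.

(** Only interior letters have to be long: the condition on [y] is void when [y] ends the chain, and
    the first letter [x] carries none. *)
Fixpoint adjchain (L : nat) (x : set G * G) (s : seq (set G * G)) : Prop :=
  if s is y :: s' then
    [/\ adjmin wl x.1 x.2 y.1 y.2, s' <> [::] -> (L <= wl y.2)%N & adjchain L y s']
  else True.

(** The union of the cosets along which the concatenated path runs: each group is translated by the
    product of the letters before it. *)
Fixpoint trace (s : seq (set G * G)) (g : G) : Prop :=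
  if s is x :: s' then x.1 g \/ trace s' (x.2^-1 * g)%g else False.

Definition good (D : R -> R -> R) (C a b : R) (f : R -> G) : Prop :=
  qgeod d 1 C a b f /\ morse_path d D a b f.

Definition locally_good D C L a b (f : R -> G) : Prop :=
  forall s t, a <= s -> s <= t -> t <= b -> t - s <= L -> good D C s t f.

Lemma leash_length D mu H h b f : leash D mu H h b f -> (wl h)%:R - 1 <= b.
Proof.
move=> [b0 [f0 fb] qf _ _]; have [q _] := qf 0 b ltac:(lra) ltac:(lra).
by move: q; rewrite f0 fb wdist1 sub0r normrN ger0_norm //; lra.
Qed.

(* A subpath of length at most [L] meets at most two consecutive pieces. *)
Lemma chain_path D mu F (Ks : seq (set G)) (L : R) (N : nat) :
  (forall H, H \in Ks -> dstable_with D mu H) ->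
  (forall H K p q b f b' g, H \in Ks -> K \in Ks -> H p -> K q ->
    adjmin wl H p K q -> leash D mu H p b f -> leash D mu K q b' g ->
    no_fellow d F 0 b (b + b') f (fun t => p * g (t - b))%g) ->
  L + 1 <= N%:R ->
  forall s x, (forall y, y \in x :: s -> y.1 \in Ks /\ y.1 y.2) -> adjchain N x s ->
  exists bx fx b f,
    [/\ leash D mu x.1 x.2 bx fx,
        [/\ bx <= b, s = [::] -> b = bx, forall t, 0 <= t <= bx -> f t = fx t &
            f b = gprod (map snd (x :: s))],
        locally_good (glue_morse 1 D F) (glue_qi_const 1 D F 1) L 0 b f,
        (forall t, 0 <= t <= b -> exists2 k, trace (x :: s) k & d (f t) k <= mu) &
        forall y, y \in x :: s -> (wl y.2)%:R - 1 <= b].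
Proof.
move=> sKs nfKs LN; elim=> [|y s IH] x xs.
  move=> _; have [xK xx] := xs x (mem_head _ _).
  have [b [f lf]] := (sKs _ xK).2 _ xx.
  have bl := leash_length lf.
  have [b0 [f0 fb] qf mf fH] := lf.
  exists b, f, b, f; split=> //.
  - by split=> //; rewrite fb /= mulg1.
  - move=> s t s0 st tb _; split.
      apply: (sub_qgeod s0 tb); apply: (qgeod_weaken dP _ _ _ _ qf);
        rewrite ?ler01 //.
      by rewrite le_max lexx.
    apply: (sub_morse_path s0 tb); apply: (morse_path_le _ mf) => l c.
    by rewrite le_max lexx.
  - by move=> t /fH[k Hk dk]; exists k => //; left.
  - by move=> y; rewrite inE => /eqP ->.
move=> [xy yL ys].
have [xK xx] := xs x (mem_head _ _).
have ysK z : z \in y :: s -> z.1 \in Ks /\ z.1 z.2.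
  by move=> zs; apply: xs; rewrite inE zs orbT.
have [yK yy] := ysK y (mem_head _ _).
have [by_ [fy [b' [f' [ly [by_b' sb' ff' f'b] lg near lens]]]]] := IH y ysK ys.
have [bx [fx lx]] := (sKs _ xK).2 _ xx.
have bxl := leash_length lx; have byl := leash_length ly.
have [by0 [fy0 fyb] qfy mfy fyH] := ly.
have [bx0 [fx0 fxb] qfx mfx fxH] := lx.
have f'0 : f' 0 = 1%g by rewrite ff' ?fy0 // lexx.
pose g t := (x.2 * f' (t - bx))%g.
have fg : fx bx = g bx by rewrite /g subrr f'0 mulg1.
pose f := glue bx fx g.
have nf := nfKs _ _ _ _ _ _ _ _ xK yK xx yy xy lx ly.
pose g1 t := (x.2 * fy (t - bx))%g.
have fg1 : fx bx = g1 bx by rewrite /g1 subrr fy0 mulg1.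
have bb : bx + by_ - bx = by_ by ring.
have qg1 : qgeod d 1 1 bx (bx + by_) g1.
  by rewrite /g1; apply/translate_qgeod/shift_qgeod; rewrite subrr bb.
have mg1 : morse_path d D bx (bx + by_) g1.
  by rewrite /g1; apply/translate_morse_path/shift_morse_path; rewrite subrr bb.
have bxy : bx <= bx + by_ by lra.
have [G1 G2] := two_pieces dP ler01 dG ler01 bx0 bxy qfx qg1 mfx mg1 fg1 nf.
have b'0 : 0 <= b' by lra.
exists bx, fx, (bx + b'), f; split=> //.
- split=> //; first by lra.
    by move=> t /andP[_ tb]; rewrite /f glue_le.
  rewrite /f (glue_ge fg); last by lra.
  by rewrite /g [bx + b']addrC addrK f'b.
- move=> t1 t2 t10 t12 t2b t12L.
  case: (leP t2 bx) => t2bx.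
    have eqf t : t1 <= t <= t2 -> fx t = f t by move=> tt; rewrite /f glue_le //;
      lra.
    split.
      apply: (eq_qgeod eqf); apply: (sub_qgeod t10 t2bx).
      by apply: (qgeod_weaken dP _ _ _ _ qfx); rewrite ?ler01 // le_max lexx.
    apply: (eq_morse_path eqf); apply: (sub_morse_path t10 t2bx).
    by apply: (morse_path_le _ mfx) => l c; rewrite le_max lexx.
  case: (leP bx t1) => t1bx.
    have eqf t : t1 <= t <= t2 -> g t = f t by move=> tt;
      rewrite /f (glue_ge fg) //; lra.
    have [||||g2 g3] := lg (t1 - bx) (t2 - bx); [lra..|].
    split.
      apply: (eq_qgeod eqf).
      by rewrite /g; apply/translate_qgeod/shift_qgeod.
    apply: (eq_morse_path eqf).
    by rewrite /g; apply/translate_morse_path/shift_morse_path.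
  (* The subpath crosses the junction. Since [y] is last or long, the subpath ends within the leash
     of [y]; the hypothesis [L + 1 <= N%:R] pays for the unit lost in [leash_length]. *)
  have t2y : t2 <= bx + by_.
    have [s0|s0] := eqVneq s [::]; first by rewrite sb' // in t2b.
    have := yL (elimN eqP s0); rewrite -(ler_nat R) => Ny.
    lra.
  have eqf t : t1 <= t <= t2 -> glue bx fx g1 t = f t.
    move=> tt; case: (leP t bx) => tb; first by rewrite /f !glue_le.
    rewrite /f (glue_ge fg (ltW tb)) (glue_ge fg1 (ltW tb)) /g /g1 ff' //; lra.
  split; first by apply: (eq_qgeod eqf); exact: sub_qgeod G1.
  by apply: (eq_morse_path eqf); exact: sub_morse_path G2.
- move=> t tb; case: (leP t bx) => tbx.
    have [|k Hk dk] := fxH t; first by lra.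
    by exists k; [left|rewrite /f glue_le].
  have [|k Hk dk] := near (t - bx); first by lra.
  exists (x.2 * k)%g; first by right; rewrite mulKg.
  by rewrite /f (glue_ge fg (ltW tbx)) /g wdist_translate.
- move=> z; rewrite inE => /orP[/eqP ->|/lens]; lra.
Qed.

Definition discrete_mltg : Prop := forall (D : R -> R -> R) (C : R), 0 <= C ->
  exists (L : R) (D' : R -> R -> R) (l' c' : R),
  [/\ 0 < L, 1 <= l', 0 <= c' & forall b f, 0 <= b -> locally_good D C L 0 b f ->
    qgeod d l' c' 0 b f /\ morse_path d D' 0 b f].

Lemma dstable_chain (Ks : seq (set G)) : discrete_mltg ->
  (forall H, H \in Ks -> dstable H) ->
  exists (N : nat) (D' : R -> R -> R) (l' c' mu : R), 1 <= l' /\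
  forall x s, (forall y, y \in x :: s -> y.1 \in Ks /\ y.1 y.2) -> adjchain N x s ->
  exists b f, [/\ 0 <= b,
    [/\ f 0 = 1%g, f b = gprod (map snd (x :: s)), qgeod d l' c' 0 b f &
        morse_path d D' 0 b f],
    (forall t, 0 <= t <= b -> exists2 k, trace (x :: s) k & d (f t) k <= mu) &
    forall y, y \in x :: s -> (wl y.2)%:R - 1 <= b].
Proof.
move=> mltg /dstable_uniform[D [mu sD]].
have [F nF] := no_fellow_uniform D mu (fun H Hs => (sD H Hs).1).
have [|L [D' [l' [c' [L0 l1 c0 H]]]]] := mltg (glue_morse 1 D F) (glue_qi_const 1
  D F 1).
  by rewrite le_max ler01.
exists (Num.truncn (L + 1)).+1, D', l', c', mu; split=> // x s xs chain.
have [|bx [fx [b [f [lx [bxb _ ff fb] lg near lens]]]]] :=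
  chain_path (L := L) sD nF _ xs chain.
  by have /andP[_ /ltW] : (Num.truncn (L + 1))%:R <= L + 1 < (Num.truncn (L +
    1)).+1%:R
    by apply: truncn_itv; lra.
have [bx0 [fx0 _] _ _ _] := lx.
have b0 : 0 <= b by lra.
have [qf mf] := H b f b0 lg.
exists b, f; split=> //; split=> //.
by rewrite ff ?fx0 // lexx.
Qed.

End Chains.

(** * The profinite topology *)

Section Profinite.
Local Open Scope group_scope.
Context (G : groupType).
Implicit Types (H K N A S : set G) (x y g : G).

Definition normal_fi N : Prop :=
  [/\ is_subgroup N, finite_index N & forall x n, N n -> N (x^-1 * n * x)].

Lemma normal_fiT : normal_fi setT.
Proof.
split=> //; first exact: is_subgroupT.
apply: (@sub_finite_set _ _ [set setT]); last exact: finite_set1.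
by move=> _ [g _ <-]; apply/seteqP; split=> // y _; exact/left_cosetP.
Qed.

Lemma normal_fiI N N' : normal_fi N -> normal_fi N' -> normal_fi (N `&` N').
Proof.
move=> [sN fN cN] [sN' fN' cN']; split; first exact: is_subgroupI.
  exact: finite_indexI.
by move=> x n [Nn Nn']; split; [exact: cN|exact: cN'].
Qed.

(** Normal subgroups of finite index are closed under intersection, so finitely many properties of
    this kind hold together for all small [N]. *)
Definition eventually_normal (P : set G -> Prop) : Prop :=
  exists2 N0, normal_fi N0 & forall N, normal_fi N -> N `<=` N0 -> P N.

Lemma eventually_normal_and P Q : eventually_normal P -> eventually_normal Q ->
  eventually_normal (fun N => P N /\ Q N).
Proof.
move=> [N1 n1 H1] [N2 n2 H2]; exists (N1 `&` N2); first exact: normal_fiI.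
move=> N nN sN; split; [apply: H1|apply: H2] => // x Nx.
  by have [] := sN x Nx.
by have [] := sN x Nx.
Qed.

Lemma eventually_normal_imp (P Q : set G -> Prop) : (forall N, normal_fi N ->
  P N -> Q N) -> eventually_normal P -> eventually_normal Q.
Proof.
by move=> PQ [N0 n0 H]; exists N0 => // N nN sN; apply: PQ => //; exact: H.
Qed.

Lemma eventually_normal_seq (T : eqType) (P : T -> set G -> Prop) (s : seq T) :
  (forall t, t \in s -> eventually_normal (P t)) ->
    eventually_normal (fun N => forall t, t \in s -> P t N).
Proof.
elim: s => [_|t s IH H]; first by exists setT => //; exact: normal_fiT.
have H1 := H t (mem_head _ _).
have H2 : eventually_normal (fun N => forall t, t \in s -> P t N).
  by apply: IH => u us; apply: H; rewrite inE us orbT.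
apply: eventually_normal_imp (eventually_normal_and H1 H2) => N _ [Pt Ps] u.
by rewrite inE => /orP[/eqP ->|/Ps].
Qed.

Lemma conjugates_finite_index K x : finite_index K ->
  finite_index (conjugate x K).
Proof.
move=> fK.
have := finite_image (fun A : set G => [set y | A (y * x)]) fK.
apply: sub_finite_set => _ [g _ <-].
exists (left_coset (g * x) K); first by exists (g * x).
apply/seteqP; split=> y.
  by move=> /= /left_cosetP Ky; apply/left_cosetP;
    rewrite /conjugate /= !mulgA -invgM -mulgA.
move=> /left_cosetP; rewrite /conjugate /= => Ky; apply/left_cosetP.
by rewrite invgM -!mulgA in Ky *.
Qed.

Lemma coset_transversal H K : is_subgroup K -> finite_index K ->
  exists s : seq G, (forall x, x \in s -> H x) /\
    forall g, H g -> exists2 x, x \in s & K (x^-1 * g).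
Proof.
move=> sK /finite_seqP[cs csE].
pose rep A := xget 1 [set g | H g /\ left_coset g K = A].
pose P A := `[< exists g, H g /\ left_coset g K = A >].
have repP A : P A -> H (rep A) /\ left_coset (rep A) K = A.
  by move=> /asboolP ex; have := @xgetPex _ 1 [set g | H g /\ left_coset g K = A]
    ex.
exists [seq rep A | A <- cs & P A]; split=> [_ /mapP[A + ->]|g Hg].
  by rewrite mem_filter => /andP[/repP[]].
have PA : P (left_coset g K) by apply/asboolP; exists g.
exists (rep (left_coset g K)).
  apply: map_f; rewrite mem_filter PA /=.
  have : [set left_coset i K | i in [set: G]] (left_coset g K) by exists g.
  by rewrite csE.
apply/left_cosetP; rewrite (repP _ PA).2; apply/left_cosetP.
by rewrite mulVg; exact: subgroup1.
Qed.

Lemma finite_index_sub K K' : K 1 -> is_subgroup K' -> K `<=` K' ->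
  finite_index K -> finite_index K'.
Proof.
move=> K1 sK' KK' fK.
have := finite_image (fun A : set G => [set y | exists a k, [/\ A a,
  K' k & y = a * k]]) fK.
apply: sub_finite_set => _ [g _ <-].
exists (left_coset g K); first by exists g.
apply/seteqP; split=> y.
  move=> [a [k [/left_cosetP Ka Kk ->]]]; apply/left_cosetP.
  by rewrite mulgA; apply: subgroupM => //; exact: KK'.
move=> /left_cosetP Ky; exists g, (g^-1 * y); split=> //; last by rewrite mulVKg.
by apply/left_cosetP; rewrite mulVg.
Qed.

(* The intersection of the finitely many conjugates. *)
Lemma normal_core K : is_subgroup K -> finite_index K ->
  exists2 N, normal_fi N & N `<=` K.
Proof.
move=> sK fK; pose N := [set n | forall x, K (x^-1 * n * x)].
have sN : is_subgroup N.
  apply: subgroup_intro => [x|a b Na Nb x|a Na x].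
  - by rewrite mulg1 mulVg; exact: subgroup1.
  - by have := subgroupM sK (Na x) (Nb x); rewrite -!mulgA mulVKg.
  - by have := subgroupV sK (Na x); rewrite !invgM invgK -!mulgA.
have [s [_ sP]] := coset_transversal setT sK fK.
exists N; last by move=> n /(_ 1); rewrite invg1 mul1g mulg1.
split=> //; last first.
  by move=> x n Nn y; have := Nn (x * y); rewrite invgM -!mulgA.
pose M := foldr (fun x A => conjugate x K `&` A) setT s.
have fM : finite_index M.
  rewrite /M; elim: (s) => [|x s' IH] /=; first by case: normal_fiT.
  by apply: finite_indexI => //; exact: conjugates_finite_index.
have MP n x : M n -> x \in s -> K (x^-1 * n * x).
  rewrite /M; elim: (s) => [|y s' IH] //= [Ky Mn].
  by rewrite inE => /orP[/eqP ->|/IH]; [exact: Ky|exact].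
have M1 : M 1.
  rewrite /M; elim: (s) => [|x s' IH] //=; split=> //.
  by rewrite /conjugate /= mulg1 mulVg; exact: subgroup1.
apply: finite_index_sub M1 sN _ fM => n Mn g.
have [x xs Kx] := sP g I.
have -> : g^-1 * n * g = (x^-1 * g)^-1 * (x^-1 * n * x) * (x^-1 * g).
  by rewrite invgM invgK -!mulgA !mulVKg.
by apply: subgroupM => //; apply: subgroupM => //; [exact: subgroupV|exact: MP].
Qed.

Lemma separableP A : separable A <->
  forall b, ~ A b -> eventually_normal (fun N => forall n, N n -> ~ A (b * n)).
Proof.
split=> [cA b nAb|H].
  have [D DB DE] := closed_openC cA.
  have : (~` A) b by [].
  rewrite -DE => -[B DB' Bb].
  have [g [K [sK fK BE]]] := DB _ DB'.
  have [N0 n0 N0K] := normal_core sK fK.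
  exists N0 => // N nN NN0 n Nn; rewrite -[~ A _]/((~` A) (b * n)) -DE.
  exists B => //; rewrite BE in Bb *; rewrite (left_coset_eq sK Bb).
  by apply/left_cosetP; rewrite mulKg; exact/N0K/NN0.
rewrite /separable -[A]setCK; apply: open_closedC; rewrite openE => b nAb.
have [N0 n0 HN] := H b nAb.
have [sN fN _] := n0.
apply: (@filterS (profinite G) _ _ (left_coset b N0)).
  by move=> x /left_cosetP Nx Ax; apply: (HN N0 n0 _ _ Nx) => //; rewrite mulVKg.
apply: open_nbhs_nbhs; split; last first.
  by apply/left_cosetP; rewrite mulVg; exact: subgroup1.
exists [set left_coset b N0]; last by rewrite bigcup_set1.
by move=> _ ->; exists b, N0.
Qed.

(** By normality, [b] in [N Z] implies that [b N] meets [Z], which separability of [Z] excludes for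
    small [N] if [b] is outside [Z]. A ball contains finitely many such [b]. This is what makes
    letters long. *)
Lemma eventually_normal_separable (M : nat) (wl : G ->
  nat) (Z : set G) : word_length wl ->
  separable Z -> eventually_normal (fun N => forall b, (wl b <= M)%N ->
    (exists n z, [/\ N n, Z z & b = n * z]) -> Z b).
Proof.
move=> wlP /separableP sZ.
have /finite_seqP[s sE] := wl_ball wlP M.
suff : eventually_normal (fun N => forall b, b \in s -> forall n z, N n -> Z z ->
  b = n * z -> Z b).
  apply: eventually_normal_imp => N _ H b bM [n [z [Nn Zz bnz]]].
  have bs : [set` s] b by rewrite -sE.
  exact: H Nn Zz bnz.
apply: eventually_normal_seq => b _.
have [Zb|nZb] := pselect (Z b); first by exists setT => //; exact: normal_fiT.
apply: eventually_normal_imp (sZ b nZb) => N [sN _ cN] H n z Nn Zz bnz.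
exfalso; apply: (H (b^-1 * n^-1 * b)); first by apply: cN; exact: subgroupV.
have -> // : b * (b^-1 * n^-1 * b) = z.
by rewrite -!mulgA mulVKg bnz mulKg.
Qed.

Lemma separable_translate u v A : separable A ->
  separable [set x | A (u * x * v)].
Proof.
move=> /separableP sA; apply/separableP => b /sA.
apply: eventually_normal_imp => N [_ _ cN] H n Nn /= An.
apply: (H (v^-1 * n * v)); first exact: cN.
by move: An; rewrite -!mulgA mulVKg.
Qed.

End Profinite.

(** * Products of sets and minimal expressions *)

Section Products.
Local Open Scope group_scope.
Context (G : groupType).
Implicit Types (A B H K N S : set G) (x y g : G) (As Bs : seq (set G)) (ys zs :
  seq G).

Lemma gprod_cat ys zs : gprod (ys ++ zs) = gprod ys * gprod zs.
Proof. by elim: ys => [|y ys IH] /=; rewrite ?mul1g // IH mulgA. Qed.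

Fixpoint inseq As ys : Prop :=
  match As, ys with
  | [::], [::] => True
  | A :: As', y :: ys' => A y /\ inseq As' ys'
  | _, _ => False
  end.

Lemma inseq_size As ys : inseq As ys -> size As = size ys.
Proof. by elim: As ys => [|A As IH] [|y ys] //= [_ /IH ->]. Qed.

Lemma inseq_cat As Bs ys zs : inseq As ys -> inseq Bs zs ->
  inseq (As ++ Bs) (ys ++ zs).
Proof. by elim: As ys => [|A As IH] [|y ys] //= [Ay /IH H] /H. Qed.

Lemma inseq_catP As Bs ys : inseq (As ++ Bs) ys ->
  exists ys1 ys2, [/\ ys = ys1 ++ ys2, inseq As ys1 & inseq Bs ys2].
Proof.
elim: As ys => [|A As IH] ys /=; first by exists [::], ys.
case: ys => // y ys [Ay /IH[ys1 [ys2 [-> H1 H2]]]].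
by exists (y :: ys1), ys2.
Qed.

Definition prodset As : set G := [set gprod ys | ys in [set ys | inseq As ys]].

Lemma prodset_nil x : prodset [::] x <-> x = 1.
Proof. by split=> [[[|//] _ <-]|->] //; exists [::]. Qed.

Lemma prodset_cons A As x :
  prodset (A :: As) x <-> exists a y, [/\ A a, prodset As y & x = a * y].
Proof.
split=> [[[//|a ys] [Aa ysAs] <-]|[a [_ [Aa [ys ysAs <-] ->]]]].
  by exists a, (gprod ys); split=> //; exists ys.
by exists (a :: ys).
Qed.

Lemma prodset_cat As Bs x :
  prodset (As ++ Bs) x <-> exists y z, [/\ prodset As y, prodset Bs z & x = y * z].
Proof.
split=> [[ys /inseq_catP[ys1 [ys2 [-> H1 H2]]] <-]|[_ [_ [[ys H1 <-] [zs H2 <-]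
  ->]]]].
  by exists (gprod ys1), (gprod ys2); rewrite gprod_cat; split=> //;
    [exists ys1|exists ys2].
by exists (ys ++ zs); [exact: inseq_cat|exact: gprod_cat].
Qed.

Lemma prodset1 A x : prodset [:: A] x <-> A x.
Proof.
split=> [/prodset_cons[a [y [Aa /prodset_nil -> ->]]]|Ax]; first by rewrite mulg1.
by exists [:: x] => //=; rewrite mulg1.
Qed.

Lemma prodset_conjugate u As x :
  prodset (map (conjugate u) As) x <-> prodset As (u^-1 * x * u).
Proof.
elim: As x => [|A As IH] x.
  split=> [/prodset_nil ->|/prodset_nil xu]; apply/prodset_nil.
    by rewrite mulg1 mulVg.
  by apply: (mulgI u^-1); apply: (mulIg u); rewrite xu mulg1 mulVg.
split=> [/prodset_cons[a [y [Aa /IH Ay ->]]]|/prodset_cons[a [y [Aa Ay xE]]]].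
  apply/prodset_cons; exists (u^-1 * a * u), (u^-1 * y * u); split=> //.
  by rewrite -!mulgA mulVKg.
apply/prodset_cons; exists (u * a * u^-1), (u * y * u^-1); split.
- by rewrite /conjugate /= -!mulgA mulKg mulVg mulg1.
- by apply/IH; rewrite -!mulgA mulKg mulVg mulg1.
- by rewrite -!mulgA mulKg [a * _]mulgA -xE -!mulgA mulVKg mulgV mulg1.
Qed.

Context (wl : G -> nat).
Implicit Types (cs : seq (set G * set G)).

(* A pair [(C, K)] is a group [K] with a set [C] of admissible elements. *)
Fixpoint movable cs : Prop :=
  match cs with
  | c :: cs' =>
    match cs' with
    | c' :: _ => forall z, c.2 z -> c'.2 z ->
        (forall y, c.1 y -> c.1 (y * z)) /\ (forall y, c'.1 y -> c'.1 (z^-1 * y))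
    | [::] => True
    end /\ movable cs'
  | [::] => True
  end.

Fixpoint adjall As ys : Prop :=
  match As, ys with
  | A :: As', y :: ys' =>
    match As', ys' with
    | A' :: _, y' :: _ => adjmin wl A y A' y'
    | _, _ => True
    end /\ adjall As' ys'
  | _, _ => True
  end.

Definition weight ys := sumn (map wl ys).

(** A corner that is not minimal supplies a [z] whose passage shortens the expression, and [movable]
    keeps both new letters admissible. As the weight decreases, [exists_adjall] ends at an
    expression with all corners minimal. *)
Lemma adjall_improve cs ys : movable cs -> inseq (map fst cs) ys ->
  ~ adjall (map snd cs) ys -> exists ys', [/\ inseq (map fst cs) ys',
    gprod ys' = gprod ys & (weight ys' < weight ys)%N].
Proof.
elim: cs ys => [|[C K] [|[C' K'] cs] IH] [|y [|y' ys]] //=.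
  by move=> _ _ [].
move=> [mv mv'] [Cy [Cy' ysC]] nadj.
have [adj|nadj'] := pselect (adjall (K' :: map snd cs) (y' :: ys)).
  have /existsNP[z /not_implyP[Kz /not_implyP[K'z /negP]]] : ~ adjmin wl K y K' y'.
    by move=> ad; exact: nadj.
  rewrite -ltnNge => lt; have [mvz mvz'] := mv z Kz K'z.
  exists (y * z :: z^-1 * y' :: ys); split=> /=.
  - by split; [exact: mvz|split; [exact: mvz'|]].
  - by rewrite !mulgA mulgK.
  - by rewrite /weight /= !addnA ltn_add2r.
have [|[|z zs] [] //] := IH (y' :: ys) mv' _ nadj'; first by split.
move=> zsC zsE lt; exists (y :: z :: zs); split=> //=.
  by move: zsE => /= ->.
by rewrite /weight /= ltn_add2l.
Qed.

Lemma exists_adjall cs ys : movable cs -> inseq (map fst cs) ys ->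
  exists ys', [/\ inseq (map fst cs) ys', gprod ys' = gprod ys & adjall (map snd
    cs) ys'].
Proof.
move=> mv; elim: (weight ys).+1 {-2}ys (ltnSn (weight ys)) => // n IH {}ys lt ysC.
have [adj|nadj] := pselect (adjall (map snd cs) ys); first by exists ys.
have [zs [zsC zsE zslt]] := adjall_improve mv ysC nadj.
have [|xs [? xsE ?]] := IH zs _ zsC; first by lia.
by exists xs; rewrite xsE zsE.
Qed.

Lemma adjchain_mid (N : nat) K y (mid : seq G) w (Ks : seq (set G)) :
  size Ks = (size mid).+1 -> adjall (K :: Ks) (y :: rcons mid w) ->
  (forall x, x \in mid -> (N <= wl x)%N) ->
  adjchain wl N (K, y) (zip Ks (rcons mid w)).
Proof.
elim: mid K y Ks => [|x mid IH] K y [|K' Ks] //=.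
  by move=> /eqP; case: Ks => // _ [ad _] _.
move=> [sz] [ad adj] long; split=> //.
  by move=> _; apply: long; exact: mem_head.
by apply: IH => // z zm; apply: long; rewrite inE zm orbT.
Qed.

Lemma zip_inseq cs ys (Ks : seq (set G)) :
  (forall c, c \in cs -> c.2 \in Ks /\ c.1 `<=` c.2) ->
  inseq (map fst cs) ys ->
  forall p, p \in zip (map snd cs) ys -> p.1 \in Ks /\ p.1 p.2.
Proof.
elim: cs ys => [|[C K] cs IH] [|y ys] //= csK [Cy ysC] p.
rewrite inE => /orP[/eqP ->|]; last first.
  by apply: IH => // c cs_; apply: csK; rewrite inE cs_ orbT.
by have [? CK] := csK (C, K) (mem_head _ _); split=> //; exact: CK.
Qed.

Lemma trace_near (R : realType) (nu : R) (A : set G)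
    (s : seq (set G * G)) g : is_subgroup A ->
  (forall p, p \in s -> A p.2 /\
     forall k, p.1 k -> exists2 a, A a & (wdist R wl k a <= nu)%R) ->
  trace s g -> exists2 a, A a & (wdist R wl g a <= nu)%R.
Proof.
move=> sA; elim: s g => [|p s IH] g //= sH [pg|].
  by apply: (sH p (mem_head _ _)).2.
move=> /IH[|a Aa da].
  by move=> q qs; apply: sH; rewrite inE qs orbT.
exists (p.2 * a); first by apply: subgroupM => //; apply: (sH p (mem_head _ _)).1.
by rewrite -(wdist_translate R wl p.2^-1) mulKg.
Qed.

End Products.

(** * Alternating products *)

Section Alternating.
Local Open Scope group_scope.
Context (G : groupType).
Implicit Types (A B C H K N S W : set G) (x y z g : G).

Definition mulset A B : set G := [set x | exists a b, [/\ A a, B b & x = a * b]].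

Definition level N S H : set G := H `&` mulset N S.

Lemma level_subgroup N S H : normal_fi N -> is_subgroup S -> is_subgroup H ->
  is_subgroup (level N S H).
Proof.
move=> [sN _ cN] sS sH; apply: subgroup_intro.
- split; first exact: subgroup1.
  by exists 1, 1; split; rewrite ?mulg1 //; exact: subgroup1.
- move=> x y [Hx [n [s [Nn Ss xE]]]] [Hy [m [t [Nm St yE]]]].
  split; first exact: subgroupM.
  exists (n * (s * m * s^-1)), (s * t); split; last by rewrite xE yE !mulgA mulgVK.
    apply: subgroupM => //; have := cN s^-1 m Nm; by rewrite invgK.
  exact: subgroupM.
- move=> x [Hx [n [s [Nn Ss xE]]]]; split; first exact: subgroupV.
  exists (s^-1 * n^-1 * s), s^-1; split; last by rewrite xE invgM mulgK.
    by apply: cN; exact: subgroupV.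
  exact: subgroupV.
Qed.

Lemma sub_level N S H : normal_fi N -> S `<=` H -> S `<=` level N S H.
Proof.
move=> [sN _ _] SH x Sx; split; first exact: SH.
by exists 1, x; split; rewrite ?mul1g //; exact: subgroup1.
Qed.

(** [level N S H] contains the intersection of [H] with [N], which has finite index in [H]. Taking
    inverses turns left coset representatives into right multipliers. *)
Lemma level_dense N S H : normal_fi N -> is_subgroup S -> is_subgroup H ->
  exists s : seq G, (forall x, x \in s -> H x) /\
    forall k, H k -> exists2 x, x \in s & level N S H (k * x).
Proof.
move=> [sN fN cN] sS sH.
have [s [sHs sP]] := coset_transversal H sN fN.
exists s; split=> // k Hk.
have [x xs Nx] := sP _ (subgroupV sH Hk).
exists x => //; split; first by apply: subgroupM => //; exact: sHs.
exists (k * x), 1; split; rewrite ?mulg1 //; last exact: subgroup1.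
by have := subgroupV sN Nx; rewrite invgM !invgK.
Qed.

Lemma setD_translate S T y z : is_subgroup S -> is_subgroup T -> S `<=` T ->
  (T `\` S) y -> S z -> (T `\` S) (y * z) /\ (T `\` S) (z * y).
Proof.
move=> sS sT ST [Ty nSy] Sz; split; (split; first by apply: subgroupM => //;
  exact: ST).
  by move=> Syz; apply: nSy; rewrite -[y](mulgK z); apply: subgroupM => //;
    exact: subgroupV.
by move=> Szy; apply: nSy; rewrite -[y](mulKg z); apply: subgroupM => //;
  exact: subgroupV.
Qed.

Section Pattern.
Context (H1 H2 N : set G).
Context (sH1 : is_subgroup H1) (sH2 : is_subgroup H2) (nN : normal_fi N).
Let S := H1 `&` H2.
Let P := level N S H1.
Let Q := level N S H2.

(** The letters avoid [S], which will make them long, but the group attached to each is all of [H2]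
    or [H1], since the leashes are taken in these stable groups. *)
Fixpoint pat (j : nat) : seq (set G * set G) :=
  if j is i.+1 then (Q `\` S, H2) :: (P `\` S, H1) :: pat i else [::].

Lemma pat_rcons j : pat j.+1 = pat j ++ [:: (Q `\` S, H2); (P `\` S, H1)].
Proof. by elim: j => //= j ->. Qed.

Lemma mem_pat j c : c \in pat j -> c = (Q `\` S, H2) \/ c = (P `\` S, H1).
Proof.
elim: j => //= j IH; rewrite !inE => /orP[/eqP ->|/orP[/eqP ->|/IH]] //;
  by [left|right].
Qed.

Let sS : is_subgroup S. Proof. exact: is_subgroupI. Qed.
Let sP : is_subgroup P. Proof. exact: level_subgroup. Qed.
Let sQ : is_subgroup Q. Proof. exact: level_subgroup. Qed.
Let SP : S `<=` P. Proof. by apply: sub_level => // x []. Qed.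
Let SQ : S `<=` Q. Proof. by apply: sub_level => // x []. Qed.

(** The values of such expressions form a set [U] stable under left multiplication by [P] and [Q],
    hence by the group they generate. A letter in [S] lies in both and merges with its neighbours; a
    last letter of [Q] goes into [W]. *)
Lemma normal_form W : (forall q w, Q q -> W w -> W (q * w)) ->
  forall a w, generated (P `|` Q) a -> W w ->
  exists j p e w', [/\ P p, prodset (map fst (pat j)) e, W w' & a * w = p * e * w'].
Proof.
move=> QW.
pose U := [set x | exists j p e w', [/\ P p, prodset (map fst (pat j)) e,
  W w' & x = p * e * w']].
have PU p x : P p -> U x -> U (p * x).
  move=> Pp [j [p' [e [w [Pp' Ee Ww ->]]]]].
  by exists j, (p * p'), e, w; rewrite !mulgA; split=> //; exact: subgroupM.
have QU q x : Q q -> U x -> U (q * x).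
  move=> Qq [j [p [e [w [Pp Ee Ww ->]]]]].
  have [Sp|nSp] := pselect (S p); last first.
    have [Sq|nSq] := pselect (S q).
      exists j, (q * p), e, w; rewrite !mulgA; split=> //.
      by apply: subgroupM => //; exact: SP.
    exists j.+1, 1, (q * (p * e)), w; rewrite !mulgA !mul1g; split=> //.
      exact: subgroup1.
    apply/prodset_cons; exists q, (p * e); rewrite mulgA; split=> //.
    by apply/prodset_cons; exists p, e.
  (* Here [p] is in [S], so [q * p] merges with the first letter [q'] of the pattern; if the result
     falls into [S], it merges in turn with [p'] and the pattern loses a pair. *)
  have Qqp : Q (q * p) by apply: subgroupM => //; exact: SQ.
  case: j Ee => [/prodset_nil ->|j].
    exists 0%N, 1, 1, (q * p * w); rewrite !mulg1 !mul1g !mulgA; split=> //.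
    - exact: subgroup1.
    - exact/prodset_nil.
    - exact: QW.
  move=> /prodset_cons[q' [x' [[Qq' nSq'] /prodset_cons[p' [e' [[Pp' nSp'] Ee'
    ->]]] ->]]].
  have Qqpq : Q (q * p * q') by exact: subgroupM.
  have [Sqpq|nSqpq] := pselect (S (q * p * q')).
    exists j, (q * p * q' * p'), e', w; rewrite !mulgA; split=> //.
    by apply: subgroupM => //; exact: SP.
  exists j.+1, 1, (q * p * q' * (p' * e')), w; rewrite !mulgA !mul1g; split=> //.
    exact: subgroup1.
  apply/prodset_cons; exists (q * p * q'), (p' * e'); rewrite !mulgA; split=> //.
  by apply/prodset_cons; exists p', e'.
pose T := [set a | forall x, U x -> U (a * x) /\ U (a^-1 * x)].
have sT : is_subgroup T.
  apply: subgroup_intro.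
  - by move=> x Ux; rewrite invg1 mul1g.
  - move=> a b Ta Tb x Ux; rewrite invgM -!mulgA; split.
      by apply: (Ta _ _).1; apply: (Tb _ _).1.
    by apply: (Tb _ _).2; apply: (Ta _ _).2.
  - by move=> a Ta x Ux; rewrite invgK; have [] := Ta x Ux.
move=> a w Aa Ww.
have /(generated_min sT) : P `|` Q `<=` T.
  move=> y [Py|Qy] x Ux; split.
  - exact: PU.
  - by apply: PU => //; exact: subgroupV.
  - exact: QU.
  - by apply: QU => //; exact: subgroupV.
move=> /(_ a Aa w)[] //.
exists 0%N, 1, 1, w; rewrite !mul1g; split=> //; first exact: subgroup1.
exact/prodset_nil.
Qed.

(** Adjacent groups of the pattern meet in [S], and multiplying by an element of [S] keeps a letter
    in its level and outside [S]. *)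
Lemma movable_pat j c0 c cs : c0.2 = H1 -> c.2 = H2 ->
  (forall y z, c0.1 y -> S z -> c0.1 (y * z)) ->
  (forall y z, c.1 y -> S z -> c.1 (z * y)) ->
  movable (c :: cs) -> movable (c0 :: pat j ++ c :: cs).
Proof.
move=> + cE + cS mv; elim: j c0 => [|j IH] c0 c0E c0S.
  split=> // z; rewrite c0E cE => zH1 zH2; split=> y yc; first by apply: c0S.
  by apply: cS => //; apply: (subgroupV sS).
have Qc y z := setD_translate (y := y) (z := z) sS sQ SQ.
have Pc y z := setD_translate (y := y) (z := z) sS sP SP.
split.
  move=> z; rewrite c0E => zH1 zH2; split=> y yc; first exact: c0S.
  by have [_] := Qc _ z^-1 yc (subgroupV sS (conj zH1 zH2)).
split.
  move=> z zH2 zH1; have Sz : S z by [].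
  split=> y yc; first by have [] := Qc y z yc Sz.
  by have [_] := Pc _ z^-1 yc (subgroupV sS Sz).
by apply: IH => // y z Py Sz; have [] := Pc y z Py Sz.
Qed.

End Pattern.

Lemma inseq_mem As (ys : seq G) y : inseq As ys -> y \in ys ->
  exists2 A, A \in As & A y.
Proof.
elim: As ys => [|A As IH] [|x ys] //= [Ax /IH H];
  rewrite inE => /orP[/eqP ->|/H[B Bs By]].
  by exists A => //; rewrite inE eqxx.
by exists B => //; rewrite inE Bs orbT.
Qed.

End Alternating.

(** * Stability of the group generated by two small levels *)

Section Combination.
Local Open Scope group_scope.
Context (R : realType) (G : groupType) (wl : G -> nat) (wlP : word_length wl).
Context (Glerf : lerf G) (mltg : discrete_mltg R wl).
Implicit Types (H K N S W : set G) (x y g : G).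

Local Notation dstable := (@dstable R G wl).

Lemma dstable_separable H : dstable H -> separable H.
Proof.
move=> sH; apply: Glerf; first exact: dstable_subgroup sH.
exact: (dstable_finitely_generated wlP sH).
Qed.

Lemma level_near N S H : normal_fi N -> is_subgroup S -> is_subgroup H ->
  exists nu : R, forall k, H k -> exists2 a, level N S H a & (wdist R wl k a <=
    nu)%R.
Proof.
move=> nN sS sH; have [s [_ sP]] := level_dense nN sS sH.
exists ((\max_(x <- s) wl x)%N%:R)%R => k Hk.
have [x xs lx] := sP k Hk.
exists (k * x) => //; rewrite /wdist mulKg ler_nat.
exact: leq_bigmax_seq.
Qed.

(** Put an element of [A] in normal form and make its corners minimal. Interior letters lie in [N S]
    but not in [S], so they are long for small [N], and the local-to-global property makes the
    concatenated path uniformly Morse. *)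
Lemma dstable_combination (H1 H2 : set G) : dstable H1 -> dstable H2 ->
  eventually_normal (fun N => dstable (generated
    (level N (H1 `&` H2) H1 `|` level N (H1 `&` H2) H2))).
Proof.
move=> st1 st2; set S := H1 `&` H2.
have sH1 := dstable_subgroup st1; have sH2 := dstable_subgroup st2.
have stS : dstable S by exact: dstable_setI.
have sS := dstable_subgroup stS.
have [|M [D' [l' [c' [mu [_ chain]]]]]] := dstable_chain wlP (Ks := [:: H1;
  H2]) mltg.
  by move=> H; rewrite !inE => /orP[/eqP ->|/eqP ->].
apply: eventually_normal_imp (eventually_normal_separable M wlP
  (dstable_separable stS)) => N nN small.
set P := level N S H1; set Q := level N S H2; set A := generated _.
have sP : is_subgroup P by exact: level_subgroup.
have sQ : is_subgroup Q by exact: level_subgroup.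
have sA : is_subgroup A := generated_subgroup (P `|` Q).
have PA : P `<=` A by move=> x Px; apply: sub_generated; left.
have QA : Q `<=` A by move=> x Px; apply: sub_generated; right.
have [nu1 near1] := level_near nN sS sH1.
have [nu2 near2] := level_near nN sS sH2.
pose nu := Num.max nu1 nu2.
(* Both groups stay near [A] because the levels have finite index in them; [nu] may depend on
   [N]. *)
have near H k : H \in [:: H1; H2] -> H k -> exists2 a,
  A a & (wdist R wl k a <= nu)%R.
  rewrite !inE => /orP[/eqP ->|/eqP ->] Hk.
    by have [a Pa da] := near1 k Hk; exists a; [exact: PA|rewrite le_max da].
  by have [a Pa da] := near2 k Hk; exists a; [exact: QA|rewrite le_max da orbT].
apply: (@dstable_intro R G wl wlP D' (mu + nu)%R 0%R) => // x Ax.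
have [||j [p [e [w [Pp [es Ees <-] Qw xE]]]]] := @normal_form _ _ _ _ sH1 sH2 nN
  Q _ x 1 Ax.
- by move=> *; exact: subgroupM.
- exact: subgroup1.
rewrite mulg1 in xE.
pose cs := (P, H1) :: pat H1 H2 N j ++ [:: (Q, H2)].
have mv : movable cs.
  apply: movable_pat => //= y z Py Sz; apply: subgroupM => //;
    apply: sub_level Sz => //.
  - by move=> ? [].
  - by move=> ? [].
have fstE : map fst cs = P :: map fst (pat H1 H2 N j) ++ [:: Q] by rewrite /cs /=
  map_cat.
have csC : inseq (map fst cs) (p :: es ++ [:: w]).
  by rewrite fstE; split=> //; apply: inseq_cat => //=.
have [ys [ysC ysE adj]] := exists_adjall wl mv csC.
have {}xE : gprod ys = x by rewrite ysE /= gprod_cat /= mulg1 xE mulgA.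
rewrite fstE in ysC; case: ys ysC {ysE} xE adj => // y ys [Py] /inseq_catP[mid
  [vs [-> midC]]].
case: vs => [|v [|? ?]] //= [Qv // _] xE adj.
have midL z : z \in mid -> (M <= wl z)%N.
  move=> /(inseq_mem midC)[C /mapP[c /mem_pat[] -> ->]] [[_ NSz] nSz];
  by rewrite leqNgt; apply/negP => /ltnW zM; apply: nSz; exact: small.
have szE : size (map snd (pat H1 H2 N j ++ [:: (Q, H2)])) = (size mid).+1.
  by rewrite -(inseq_size midC) !size_map size_cat addn1.
have csub c : c \in cs -> c.2 \in [:: H1; H2] /\ c.1 `<=` c.2 /\ c.1 `<=` A.
  have in1 : H1 \in [:: H1; H2] by rewrite inE eqxx.
  have in2 : H2 \in [:: H1; H2] by rewrite !inE eqxx orbT.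
  rewrite inE mem_cat inE => /orP[/eqP ->|/orP[/mem_pat[] ->|/eqP ->]] /=.
  - by split=> //; split=> // z [].
  - by split=> //; split=> z [[H2z NSz] _] //; exact: QA.
  - by split=> //; split=> z [[H1z NSz] _] //; exact: PA.
  - by split=> //; split=> // z [].
have ysC : inseq (map fst cs) (y :: rcons mid v).
  by rewrite -cats1 fstE; split=> //; apply: inseq_cat.
have {}adj : adjall wl (H1 :: map snd (pat H1 H2 N j ++ [:: (Q,
  H2)])) (y :: rcons mid v).
  by rewrite -cats1.
have := adjchain_mid szE adj midL.
have szz : (size (y :: rcons mid v) <= size (map snd cs))%N.
  by rewrite -(inseq_size ysC) !size_map.
have memz : forall q, q \in zip (map snd cs) (y :: rcons mid v) ->
    q.1 \in [:: H1; H2] /\ q.1 q.2.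
  by apply: zip_inseq ysC => c /csub[? []].
move=> /(chain (H1, y) _ memz)[b [f [b0 [f0 fb qf mf] trf _]]].
exists 0%R, b, f; split=> //.
- by rewrite f0 (pmxx (wdist_pseudometric R wlP)).
- have -> : f b = x.
    rewrite fb -xE -[(H1, y) :: _]/(zip (map snd cs) (y :: rcons mid v)).
    by rewrite -/(unzip2 _) unzip2_zip //= cats1.
  by rewrite (pmxx (wdist_pseudometric R wlP)).
move=> t /trf[k trk dk].
have [|a Aa da] := trace_near (wl := wl) (nu := nu) (A := A) sA _ trk.
  move=> q qz; have [q1 q12] := memz q qz; split; last by move=> k' ?;
    apply: near q1 _.
  have qy : q.2 \in y :: rcons mid v.
    rewrite -(unzip2_zip (s := map snd cs) (t := y :: rcons mid v));
      first exact: map_f.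
    exact: szz.
  have [C /mapP[c /csub[_ [_ cA]] ->] Cq] := inseq_mem ysC qy.
  exact: cA.
exists a => //.
have := pm_tri (wdist_pseudometric R wlP) (f t) k a.
lra.
Qed.

End Combination.

(** * Separability of products *)

Section ProductsSeparable.
Local Open Scope group_scope.
Context (R : realType) (G : groupType) (wl : G -> nat) (wlP : word_length wl).
Context (Glerf : lerf G) (mltg : discrete_mltg R wl).
Implicit Types (H K N S W Z : set G) (x y g : G) (Ks Zs : seq (set G)).

Local Notation dstable := (@dstable R G wl).

Lemma inseq_catPr Ks (ys1 ys2 : seq G) y : inseq Ks (ys1 ++ y :: ys2) ->
  exists Ks1 K Ks2, [/\ Ks = Ks1 ++ K :: Ks2, inseq Ks1 ys1, K y & inseq Ks2 ys2].
Proof.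
elim: ys1 Ks => [|x ys1 IH] [|K Ks] //= [Kx].
  by move=> H; exists [::], K, Ks.
by move=> /IH[Ks1 [K' [Ks2 [-> H1 K'y H2]]]]; exists (K :: Ks1), K', Ks2.
Qed.

Lemma prodset_absorb Ks1 K Ks2 y x : K y ->
  prodset (Ks1 ++ map (conjugate y) Ks2) x -> prodset (Ks1 ++ K :: Ks2) (x * y).
Proof.
move=> Ky /prodset_cat[a [b [Ha /prodset_conjugate Hb ->]]].
apply/prodset_cat; exists a, (y * (y^-1 * b * y)); split=> //.
  by apply/prodset_cons; exists y, (y^-1 * b * y).
by rewrite -!mulgA mulVKg.
Qed.

Lemma movable_diag Ks : (forall K, K \in Ks -> is_subgroup K) ->
  movable [seq (K, K) | K <- Ks].
Proof.
elim: Ks => //= K [|K' Ks] IH sKs //=; split; last first.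
  by apply: IH => K'' K''s; apply: sKs; rewrite inE K''s orbT.
have sK : is_subgroup K by apply: sKs; rewrite inE eqxx.
have sK' : is_subgroup K' by apply: sKs; rewrite !inE eqxx orbT.
move=> z Kz K'z; split=> y; first by move=> Ky; exact: subgroupM.
by move=> K'y; apply: subgroupM => //; exact: subgroupV.
Qed.

Lemma movable_cons_diag C H Ks : (forall K, K \in Ks -> is_subgroup K) ->
  (forall K Ks', Ks = K :: Ks' -> forall z, H z -> K z -> forall x, C x ->
    C (x * z)) ->
  movable ((C, H) :: [seq (K, K) | K <- Ks]).
Proof.
move=> sK CK; split; last exact: movable_diag.
case: Ks sK CK => //= K Ks sK CK z Hz Kz; split; first exact: CK erefl _ Hz Kz.
have sK0 : is_subgroup K by apply: sK; rewrite inE eqxx.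
by move=> y Ky; apply: subgroupM => //; exact: subgroupV.
Qed.

Section Avoidance.
Context (H1 H2 : set G) (st1 : dstable H1) (st2 : dstable H2) (m : nat).
Context (IHm : forall Ks, (size Ks <= m)%N -> (forall K, K \in Ks -> dstable K) ->
  separable (prodset Ks)).
Context (g : G) (W : set G).
Let S := H1 `&` H2.

(* The factors [e] and [y] are long since they avoid [S]. During reductions [p]
   gets multiplied by elements of the groups in [Zs], so that only its class
   modulo a small [N] is controlled; [v] collects the short factors of the tail
   [k] that have been moved to the right end. *)
Definition avoids N Zs Ks v : Prop :=
  forall j,
    (forall h e y w, H1 h -> prodset (map fst (pat H1 H2 N j)) e ->
      (level N S H2 `\` S) y -> W w -> g <> h * e * y * w) ->
    forall h e y p k, H1 h -> prodset (map fst (pat H1 H2 N j)) e ->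
      (level N S H2 `\` S) y -> H1 p -> mulset N (prodset Zs) p -> prodset Ks k ->
      g <> h * e * y * p * k * v.

(** These conditions keep the admissible [p] stable under [S] on the left and under the intersection
    of [H1] with the first group of [Ks] on the right, place [p * k * v] in [W] when [p] is in the
    product of [Zs], and bound the number of factors so that [IHm] applies to [Zs]. *)
Definition compatible Zs Ks v : Prop :=
  [/\ forall K, K \in Ks -> dstable K, forall Z, Z \in Zs -> dstable Z,
     forall s z, S s -> prodset Zs z -> prodset Zs (s * z),
     forall K Ks', Ks = K :: Ks' -> forall z y, prodset Zs z -> H1 y -> K y ->
       prodset Zs (z * y) &
     (forall z k, prodset Zs z -> prodset Ks k -> W (z * k * v)) /\
     (size Zs <= m)%N /\ (size Zs + size Ks <= m.+1)%N].

(** Removing the first letter of the tail makes the conjugate of [K'] the new neighbour of [p], so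
    its intersection with [H1] joins [Zs]. Otherwise the neighbour of [p] is unchanged or absent. *)
Definition absorb_groups Zs Ks1 Ks2 y : seq (set G) :=
  if Ks1 is [::] then if Ks2 is K' :: _ then rcons Zs (H1 `&` conjugate y K')
    else Zs
  else Zs.

(** One group leaves the tail and at most one joins [Zs], so the sizes remain bounded. A factor from
    the added group is pushed into the first factor of the tail, which keeps the product in [W]. *)
Lemma compatible_absorb Zs Ks1 K Ks2 y v : K y ->
  compatible Zs (Ks1 ++ K :: Ks2) v ->
  compatible (absorb_groups Zs Ks1 Ks2 y) (Ks1 ++ map (conjugate y) Ks2) (y * v).
Proof.
move=> Ky [stK stZ SZ ZK [ZKW [sz1 sz2]]].
have stK2 K' : K' \in Ks2 -> dstable (conjugate y K').
  move=> K'2; apply: dstable_conjugate => //; apply: stK.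
  by rewrite mem_cat inE K'2 !orbT.
have stKs K' : K' \in Ks1 ++ map (conjugate y) Ks2 -> dstable K'.
  rewrite mem_cat => /orP[K'1|/mapP[K'' K''2 ->]]; last exact: stK2.
  by apply: stK; rewrite mem_cat K'1.
have ZKW' z k : prodset Zs z -> prodset (Ks1 ++ map (conjugate y) Ks2) k ->
    W (z * k * (y * v)).
  move=> Zz /(prodset_absorb Ky) Kk; have := ZKW z _ Zz Kk.
  by rewrite !mulgA.
case: Ks1 stK ZK ZKW sz2 stKs ZKW' => [|K0 Ks1] stK ZK ZKW sz2 stKs ZKW';
  last first.
  split=> //; first by move=> K' Ks' [<- _]; exact: (ZK _ _ erefl).
  split=> //; split=> //; move: sz2; rewrite /= !size_cat size_map /=; lia.
case: Ks2 stK ZK ZKW sz2 stKs ZKW' stK2 => [|K' Ks2] stK ZK ZKW sz2 stKs ZKW' stK2.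
  by split=> //; split=> //; split=> //; move: sz2 => /=; lia.
have stX : dstable (H1 `&` conjugate y K').
  by apply: dstable_setI => //; apply: stK2; rewrite inE eqxx.
rewrite /absorb_groups -cats1; split=> //.
- by move=> Z; rewrite mem_cat !inE => /orP[/stZ|/eqP ->].
- move=> s _ Ss /prodset_cat[z [x [Zz Xx ->]]]; apply/prodset_cat.
  by exists (s * z), x; rewrite mulgA; split=> //; exact: SZ.
- move=> K'' Ks' [<- _] z0 x + HH KK => /prodset_cat[z [t [Zz /prodset1 Xt ->]]].
  apply/prodset_cat; exists z, (t * x); rewrite mulgA; split=> //.
  by apply/prodset1; apply: subgroupM => //; exact: dstable_subgroup stX.
split; last by rewrite size_cat addn1; move: sz2 => /=; rewrite size_map; lia.
move=> _ k /prodset_cat[z [x [Zz /prodset1[_ Xx] ->]]] /prodset_cons[a [b [Ka Kb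
  ->]]].
rewrite -[z * x * _]mulgA [x * _]mulgA; apply: ZKW' => //.
apply/prodset_cons; exists (x * a), b; split=> //.
apply: subgroupM => //; apply: dstable_subgroup; apply: stK2.
by rewrite inE eqxx.
Qed.

Lemma sub_absorb Zs Ks1 K Ks2 y v : compatible Zs (Ks1 ++ K :: Ks2) v ->
  K y -> prodset Zs `<=` prodset (absorb_groups Zs Ks1 Ks2 y).
Proof.
move=> [stK _ _ _ _] Ky z Zz; rewrite /absorb_groups.
case: Ks1 stK => // stK; case: Ks2 stK => // K' Ks2 stK.
rewrite -cats1; apply/prodset_cat; exists z, 1; rewrite mulg1; split=> //.
apply/prodset1; apply: subgroup1; apply: is_subgroupI;
  first exact: dstable_subgroup st1.
by apply: conjugate_subgroup; apply: dstable_subgroup; apply: stK;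
  rewrite !inE eqxx !orbT.
Qed.

(** Take an expression of [g * v^-1] with minimal corners. A short letter of the tail belongs to a
    finite ball and is moved to the right, which leaves a shorter tail. Without short letters there,
    the resulting quasigeodesic is too long to end at [g * v^-1]. *)
Lemma eventually_avoids Zs Ks v : compatible Zs Ks v ->
  eventually_normal (fun N => avoids N Zs Ks v).
Proof.
elim: (size Ks).+1 {-2}Ks (ltnSn (size Ks)) Zs v => {Ks} // n IH Ks ltKs Zs v comp.
have [stK stZ SZ ZK [ZKW [sz1 sz2]]] := comp.
have sH1 := dstable_subgroup st1; have sH2 := dstable_subgroup st2.
have stS : dstable S by exact: dstable_setI.
have sS := dstable_subgroup stS.
have sK K : K \in Ks -> is_subgroup K by move=> /stK; exact: dstable_subgroup.
pose g' := g * v^-1; set Z := prodset Zs in SZ ZK ZKW *.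
have [|M [D' [l' [c' [mu [l1 chain]]]]]] := dstable_chain wlP (Ks :=
  [:: H1, H2 & Ks]) mltg.
  by move=> H; rewrite !inE => /orP[/eqP ->|/orP[/eqP ->|/stK]].
(* An [(l', c')]-quasigeodesic from [1] to [g'] has a domain of length at most [X]. The [.+2] below
   makes [tau] exceed [X + 1], one unit being lost between the length of a letter and that of the
   path. *)
pose X := (l' * (wl g')%:R + c')%R.
pose tau := maxn M (Num.truncn X).+2.
have /finite_seqP[ball ballE] := wl_ball wlP tau.
have evS := eventually_normal_separable tau wlP (dstable_separable wlP Glerf stS).
have evZ := eventually_normal_separable tau wlP (IHm sz1 stZ).
(* There are finitely many positions [i] and short letters [y], so the induction hypothesis can be
   imposed for all of them at once. *)
have evK : eventually_normal (fun N => forall i, i \in iota 0 (size Ks) ->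
  forall y, y \in ball ->
    nth set0 Ks i y -> avoids N (absorb_groups Zs (take i Ks) (drop i.+1 Ks) y)
      (take i Ks ++ map (conjugate y) (drop i.+1 Ks)) (y * v)).
  apply: eventually_normal_seq => i; rewrite mem_iota add0n leq0n /= => iK.
  apply: eventually_normal_seq => y _.
  have [Ky|nKy] := pselect (nth set0 Ks i y); last first.
    by exists setT => //; exact: normal_fiT.
  have comp' : compatible (absorb_groups Zs (take i Ks) (drop i.+1 Ks) y)
      (take i Ks ++ map (conjugate y) (drop i.+1 Ks)) (y * v).
    by apply: compatible_absorb Ky _; rewrite -drop_nth // cat_take_drop.
  have lt' : (size (take i Ks ++ map (conjugate y) (drop i.+1 Ks)) < n)%N.
    by rewrite size_cat size_map size_take size_drop iK; lia.
  by apply: eventually_normal_imp (IH _ lt' _ _ comp') => N _; exact.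
apply: eventually_normal_imp (eventually_normal_and evS (eventually_normal_and
  evZ evK)) => N nN [smallS [smallZ smallK]].
move=> j notW h e y p k Hh Ee Qy Hp NZp Kk gE.
set Q := level N S H2 in notW Qy *; pose P := level N S H1.
have sP : is_subgroup P by exact: level_subgroup.
have sQ : is_subgroup Q by exact: level_subgroup.
have SQ : S `<=` Q by apply: sub_level => // ? [].
(* For [p] in [Z] the last factors would combine into an element of [W], against [notW]. *)
have nZp : ~ Z p.
  move=> Zp; apply: (notW h e y (p * k * v)) => //; first exact: ZKW.
  by rewrite gE !mulgA.
pose Zc := (H1 `&` mulset N Z) `\` Z.
pose tail := (Zc, H1) :: [seq (K, K) | K <- Ks].
pose cs := (H1, H1) :: pat H1 H2 N j ++ (Q `\` S, H2) :: tail.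
have mv : movable cs.
  apply: movable_pat => //=.
  - by move=> x z H1x [H1z _]; exact: subgroupM.
  - by move=> x z Qx Sz; have [] := setD_translate sS sQ SQ Qx Sz.
  split.
    move=> z H2z H1z; have Sz : S z by [].
    split=> x; first by move=> Qx; have [] := setD_translate sS sQ SQ Qx Sz.
    have Sz' := subgroupV sS Sz.
    move=> [[H1x [a [b [Na Zb xE]]]] nZx]; split; last first.
      by move=> Zzx; apply: nZx; rewrite -[x](mulVKg z); exact: SZ.
    split; first by apply: subgroupM => //; exact: subgroupV.
    exists (z^-1 * a * z), (z^-1 * b); split; last by rewrite xE !mulgA mulgK.
      by have [_ _] := nN; exact.
    exact: SZ.
  apply: movable_cons_diag => // K Ks' KsE z H1z Kz.
  have K'z : K z^-1 by apply: subgroupV => //; apply: sK; rewrite KsE inE eqxx.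
  move=> x [[H1x [a [b [Na Zb xE]]]] nZx]; split; last first.
    move=> Zxz; apply: nZx; rewrite -[x](mulgK z).
    by apply: (ZK _ _ KsE) => //; exact: subgroupV.
  split; first exact: subgroupM.
  exists a, (b * z); split=> //; last by rewrite xE mulgA.
  exact: (ZK _ _ KsE).
have [es Ees eE] := Ee; have [ks Kks kE] := Kk.
have fstE : map fst cs = H1 :: map fst (pat H1 H2 N j) ++ Q `\` S :: Zc :: Ks.
  by rewrite /cs /tail /= map_cat /= -map_comp map_id.
have sndE : map snd cs = H1 :: map snd (pat H1 H2 N j) ++ H2 :: H1 :: Ks.
  by rewrite /cs /tail /= map_cat /= -map_comp map_id.
have csC : inseq (map fst cs) (h :: es ++ y :: p :: ks).
  by rewrite fstE; split=> //; apply: inseq_cat.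
have [ys [ysC ysE adj]] := exists_adjall wl mv csC.
have {ysE} ysg : gprod ys = g'.
  by rewrite ysE /= gprod_cat /= eE kE /g' gE !mulgA mulgK.
rewrite fstE in ysC; case: ys ysC ysg adj => // h' ys [Hh'].
move=> /inseq_catP[es' [zs [-> Ees']]].
case: zs => [|y' [|p' ks']] //=; first by case.
move=> [Qy' [Zp' Kks']] ysg adj.
have [short|long] := pselect (exists2 x, x \in ks' & (wl x <= tau)%N).
  (* Moving the short [x] to the right end turns the equation into one of the finitely many cases
     excluded by [smallK]. *)
  case: short => x /splitPr kxk xtau; case: kxk Kks' ysg adj => k1 k2 Kks' ysg adj.
  have [Ks1 [K [Ks2 [KsE Kk1 Kx Kk2]]]] := inseq_catPr Kks'.
  have iK : size Ks1 \in iota 0 (size Ks).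
    by rewrite mem_iota add0n KsE size_cat /=; lia.
  have xball : x \in ball by have : [set` ball] x by rewrite -ballE.
  have := smallK _ iK x xball.
  rewrite KsE take_size_cat // nth_cat ltnn subnn -cat_rcons drop_size_cat
    ?size_rcons //.
  move=> /(_ Kx j notW h' (gprod es') y' p' (gprod k1 * (x * gprod k2 * x^-1))).
  case: Zp' => [[H1p' [a [b [Na Zb p'E]]]] _]; apply=> //.
  - by exists es'.
  - exists a, b; split=> //; have comp2 := comp; rewrite KsE in comp2.
    exact: (sub_absorb comp2 Kx Zb).
  - apply/prodset_cat; exists (gprod k1), (x * gprod k2 * x^-1); split=> //;
    first by exists k1.
    apply/prodset_conjugate; rewrite -!mulgA mulKg mulVg mulg1; by exists k2.
  - have -> : g = g' * v by rewrite /g' mulgVK.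
    by rewrite -ysg !gprod_cat /= !gprod_cat /= -!mulgA mulKg.
have tauL z : z \in es' ++ y' :: p' :: ks' -> (tau < wl z)%N.
  rewrite mem_cat !inE ltnNge => /orP[/(inseq_mem Ees')[C /mapP[c /mem_pat cE
    ->]]|].
    by case: cE => -> [[_ NSz] nSz]; apply/negP => zM; apply: nSz; exact: smallS.
  move=> /orP[/eqP ->|/orP[/eqP ->|zk]]; apply/negP => zM.
  - by case: Qy' => [[_ NSz] nSz]; apply: nSz; exact: smallS.
  - by case: Zp' => [[_ NZz] nZz]; apply: nZz; exact: smallZ.
  - by apply: long; exists z.
pose mid := es' ++ belast y' (p' :: ks'); pose w := last y' (p' :: ks').
have midE : es' ++ y' :: p' :: ks' = rcons mid w by rewrite lastI -rcons_cat.
have {}ysC : inseq (map fst cs) (h' :: rcons mid w).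
  by rewrite fstE -midE; split=> //; apply: inseq_cat.
have szE : size (map snd (pat H1 H2 N j) ++ H2 :: H1 :: Ks) = (size mid).+1.
  have := inseq_size ysC; rewrite fstE /= size_rcons => -[<-].
  by rewrite !size_cat !size_map.
have midL z : z \in mid -> (M <= wl z)%N.
  move=> zm; have : (tau < wl z)%N by apply: tauL;
    rewrite midE mem_rcons inE zm orbT.
  by rewrite /tau; lia.
have {}adj : adjall wl (H1 :: map snd (pat H1 H2 N j) ++ H2 :: H1 :: Ks) (h' ::
  rcons mid w).
  by rewrite -midE -sndE.
have := adjchain_mid szE adj midL.
have memz : forall q, q \in zip (map snd cs) (h' :: rcons mid w) ->
    q.1 \in [:: H1, H2 & Ks] /\ q.1 q.2.
  apply: zip_inseq ysC => c.
  rewrite inE mem_cat !inE => /orP[/eqP ->|/orP[/mem_pat[] ->|/orP[/eqP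
    ->|/orP[/eqP ->|/mapP[K Ks_ ->]]]]];
    rewrite /= ?eqxx ?Ks_ ?orbT; split=> //; by [move=> ? [[? ?] ?]|move=> ? [? ?]].
rewrite sndE in memz.
move=> /(chain (H1, h') _ memz)[b [f [b0 [f0 fb qf _] _ lens]]].
have fbE : f b = g'.
  rewrite fb -ysg -[(H1, h') :: _]/(zip (H1 :: (map snd (pat H1 H2 N j) ++ H2 ::
    H1 :: Ks)) (h' :: rcons mid w)).
  by rewrite -/(unzip2 _) unzip2_zip /= ?midE // szE size_rcons.
have [||_ qb] := qf 0%R b; rewrite ?lexx ?b0 //.
rewrite f0 fbE wdist1 sub0r normrN ger0_norm // -/X in qb.
(* The letter [y'] is always present, and its length alone forces the domain to be longer than
   [X]. *)
have yin : exists2 q, q \in (H1, h') :: zip (map snd (pat H1 H2 N j) ++ H2 :: H1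
  :: Ks) (rcons mid w) & q.2 = y'.
  have : y' \in unzip2 ((H1, h') :: zip (map snd (pat H1 H2 N j) ++ H2 :: H1 ::
    Ks) (rcons mid w)).
    by rewrite /= unzip2_zip ?szE ?size_rcons // -midE inE mem_cat inE eqxx !orbT.
  by move=> /mapP[q qin ->]; exists q.
have [q qin qE] := yin.
have := lens q qin; rewrite qE => yb.
have : (tau < wl y')%N by apply: tauL; rewrite mem_cat inE eqxx orbT.
rewrite -(ltr_nat R) => ty.
have tX : ((Num.truncn X).+2%:R <= (tau%:R : R))%R by rewrite ler_nat leq_maxr.
have tX' : (X + 1 < tau%:R)%R.
  by apply: lt_le_trans tX; rewrite -(natr1 (Num.truncn X).+1) ltrD2r truncnS_gt.
lra.
Qed.

End Avoidance.

Lemma separable_unit : separable ([set 1] : set G).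
Proof.
have s1 : is_subgroup ([set 1] : set G).
  by apply: subgroup_intro => [|x y -> ->|x ->] //=; rewrite ?mulg1 ?invg1.
apply: Glerf => //; exists set0; first exact: finite_set0.
apply/seteqP; split; last exact: generated_min.
by move=> _ ->; exact: subgroup1 (generated_subgroup set0).
Qed.

Lemma products_separable n Ks : (size Ks <= n)%N ->
  (forall K, K \in Ks -> dstable K) -> separable (prodset Ks).
Proof.
elim: n Ks => [|m IH] [|H1 [|H2 Ks]] //= szKs stK.
1,2: have -> : prodset [::] = [set 1 : G] by apply/seteqP; split=> x /prodset_nil.
1,2: exact: separable_unit.
  have -> : prodset [:: H1] = H1 by apply/seteqP; split=> x /prodset1.
  by apply: (dstable_separable wlP Glerf); apply: stK; rewrite inE eqxx.
have st1 : dstable H1 by apply: stK; rewrite !inE eqxx.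
have st2 : dstable H2 by apply: stK; rewrite !inE eqxx orbT.
have stKs K : K \in Ks -> dstable K by move=> Ks_; apply: stK;
  rewrite !inE Ks_ !orbT.
have sH1 := dstable_subgroup st1; have sH2 := dstable_subgroup st2.
set S := H1 `&` H2; have stS : dstable S by exact: dstable_setI.
have sS := dstable_subgroup stS.
set W := prodset (H2 :: Ks).
have H2W x w : H2 x -> W w -> W (x * w).
  move=> H2x /prodset_cons[a [b [H2a Kb ->]]]; apply/prodset_cons.
  by exists (x * a), b; rewrite mulgA; split=> //; exact: subgroupM.
apply/separableP => g ngH.
(* At the start [p] is in the level of [H1], hence in [N S]; the tail is all of [H2 :: Ks], and no
   letter has been moved to the right yet. *)
have comp : compatible H1 H2 m W [:: S] (H2 :: Ks) 1.
  split.
  - by move=> K Ks_; apply: stK; rewrite inE Ks_ orbT.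
  - by move=> Z; rewrite inE => /eqP ->.
  - by move=> s z Ss /prodset1 Sz; apply/prodset1; exact: (subgroupM sS).
  - move=> K Ks' [<- _] z y /prodset1 Sz H1y H2y; apply/prodset1.
    exact: (subgroupM sS).
  - split; last by rewrite /=; lia.
    by move=> z k /prodset1[_ H2z] Wk; rewrite mulg1; exact: H2W.
have ev := eventually_avoids st1 st2 IH g comp.
have [N0 n0 HN] := eventually_normal_and ev (dstable_combination wlP Glerf mltg
  st1 st2).
have [avoid stA] := HN N0 n0 (fun _ => id).
rewrite -/S in stA.
set P := level N0 S H1 in stA; set Q := level N0 S H2 in stA.
set A := generated (P `|` Q) in stA.
have sA := dstable_subgroup stA.
have PA : P `<=` A by move=> x Px; apply: sub_generated; left.
have QA : Q `<=` A by move=> x Px; apply: sub_generated; right.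
(* Induction on the number of pairs: for the last pair [y], [p'], the property [avoid] reduces to
   expressions with one pair fewer, their last letter in [Q] being absorbed into [W]. *)
have nf j h e w : H1 h -> prodset (map fst (pat H1 H2 N0 j)) e -> W w ->
  g <> h * e * w.
  elim: j h e w => [|j IHj] h e w Hh.
    move=> /prodset_nil -> Ww gE; apply: ngH.
    by apply/prodset_cons; exists h, w; rewrite gE mulg1.
  rewrite pat_rcons map_cat => /prodset_cat[e' [x [Ee' Ex ->]]] Ww.
  move: Ex => /prodset_cons[y [p' [Qy /prodset1 Pp ->]]].
  have notW h' f y' w' : H1 h' -> prodset (map fst (pat H1 H2 N0 j)) f ->
      (Q `\` S) y' -> W w' -> g <> h' * f * y' * w'.
    move=> Hh' Ef [[H2y' _] _] Ww'; rewrite -mulgA; apply: IHj => //.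
    exact: H2W.
  have := avoid j notW h e' y p' w Hh Ee' Qy.
  rewrite mulg1 !mulgA; apply=> //; first by case: Pp => -[].
  case: Pp => -[_ [a [b [Na Sb ->]]]] _.
  by exists a, b; split=> //; apply/prodset1.
have avoidA h a w : H1 h -> A a -> W w -> g <> h * a * w.
  move=> Hh Aa Ww; rewrite -mulgA.
  have [|j [p [e [w' [[H1p _] Ee Ww' ->]]]]] := @normal_form _ _ _ _ sH1 sH2 n0 W
    _ a w Aa Ww.
    by move=> q w' [H2q _]; exact: H2W.
  by rewrite !mulgA; apply: (nf j (h * p) e w') => //;
    exact: (subgroupM sH1 Hh H1p).
have [r1 [r1H r1P]] := level_dense n0 sS sH1.
have [r2 [r2H r2P]] := level_dense n0 sS sH2.
(* Since the levels have finite index in [H1] and [H2], finitely many translates of products of [A]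
   with conjugates of [Ks] cover the whole product. Each has one factor fewer, so [IH] applies. *)
pose B (xt : G * G) := [set b | prodset (A :: map (conjugate xt.2^-1) Ks)
  (xt.1^-1 * b * xt.2)].
have evB : eventually_normal (fun N => forall xt, xt \in [seq (x, t) | x <- r1,
  t <- r2] ->
    forall n, N n -> ~ B xt (g * n)).
  apply: eventually_normal_seq => _ /allpairsP[[x t] [/= xr tr ->]].
  have sepB : separable (B (x, t)).
    apply: (@separable_translate G x^-1 t); apply: IH => [|K];
      first by rewrite /= size_map.
    rewrite inE => /orP[/eqP -> //|/mapP[K' /stKs stK' ->]].
    exact: dstable_conjugate.
  apply: (proj1 (separableP _) sepB) => /prodset_cons[a [w [Aa /prodset_conjugate
    Kw]]].
  rewrite invgK in Kw => /= gE.
  apply: (avoidA x a (t^-1 * (t * w * t^-1)) (r1H _ xr) Aa).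
    apply/prodset_cons; exists t^-1, (t * w * t^-1); split=> //.
    by apply: subgroupV => //; exact: r2H.
  by rewrite -!mulgA mulKg !mulgA -[x * a * w]mulgA -gE !mulgA mulgV mul1g mulgK.
apply: eventually_normal_imp evB => N nN BN n Nn /prodset_cons[h [_ [Hh
  /prodset_cons[h2 [v [Hh2 Kv ->]]] gnE]]].
have [x xr Px] := r1P _ (subgroupV sH1 Hh).
have [t tr Qt] := r2P _ Hh2.
apply: (BN (x, t) _ n Nn); first by apply/allpairsP; exists (x, t).
apply/prodset_cons; exists ((h^-1 * x)^-1 * (h2 * t)), (t^-1 * v * t); split.
- apply: (subgroupM sA); last exact: QA.
  by apply: (subgroupV sA); exact: PA.
- by apply/prodset_conjugate; rewrite invgK -!mulgA mulVKg mulgV mulg1.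
- by rewrite /= gnE invgM invgK -!mulgA mulVKg.
Qed.

End ProductsSeparable.

(** * Cayley graphs *)

Section WordLengthOfGenerators.
Context (G : groupType) (S : generating_set G).
Implicit Types (x y g h : G) (s : seq G).

Definition letter x : Prop := gens S x \/ gens S x^-1%g.

Lemma cayley_adjE g h : cayley_adj S g h <-> letter (g^-1 * h)%g.
Proof. by rewrite /cayley_adj /letter invgM invgK. Qed.

Definition word s g : Prop := (forall x, x \in s -> letter x) /\ gprod s = g.

Lemma gprodV s : (gprod s)^-1%g = gprod (rev (map (fun x => x^-1)%g s)).
Proof.
elim: s => [|x s IH] /=; first by rewrite invg1.
by rewrite invgM IH rev_cons -cats1 gprod_cat /= mulg1.
Qed.

Lemma word_cat s s' g h : word s g -> word s' h -> word (s ++ s') (g * h)%g.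
Proof.
move=> [sl <-] [sl' <-]; split; last exact: gprod_cat.
by move=> x; rewrite mem_cat => /orP[/sl|/sl'].
Qed.

Lemma word_inv s g : word s g -> word (rev (map (fun x => x^-1)%g s)) g^-1%g.
Proof.
move=> [sl <-]; split; last by rewrite gprodV.
move=> x; rewrite mem_rev => /mapP[y /sl yl ->].
by case: yl; [right|left]; rewrite ?invgK.
Qed.

Lemma word_exists g : exists s, word s g.
Proof.
suff : [set g | exists s, word s g] = setT by move=> E; have : [set: G] g by [];
  rewrite -E.
apply: (generatedP (S := S)); last first.
  move=> x Sx; exists [:: x]; split; last by rewrite /= mulg1.
  by move=> y; rewrite inE => /eqP ->; left.
apply: subgroup_intro.
- by exists [::]; split=> // x; rewrite in_nil.
- by move=> x y [s sx] [s' sy]; exists (s ++ s'); exact: word_cat.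
- by move=> x [s sx]; eexists; exact: word_inv sx.
Qed.

Lemma word_size_exists g : exists n, `[< exists2 s, word s g & size s = n >].
Proof. by have [s sg] := word_exists g; exists (size s); apply/asboolP;
  exists s. Qed.

Definition wordlen g : nat := ex_minn (word_size_exists g).

Lemma wordlen_word g : exists2 s, word s g & size s = wordlen g.
Proof. by rewrite /wordlen; case: ex_minnP => n /asboolP. Qed.

Lemma wordlen_le g s : word s g -> (wordlen g <= size s)%N.
Proof.
by move=> sg; rewrite /wordlen; case: ex_minnP => n _; apply; apply/asboolP;
  exists s.
Qed.

Lemma wordlenM g h : (wordlen (g * h)%g <= wordlen g + wordlen h)%N.
Proof.
have [s sg <-] := wordlen_word g; have [s' sh <-] := wordlen_word h.
by rewrite -size_cat; apply: wordlen_le; exact: word_cat.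
Qed.

Lemma wordlen_prefix g : exists w : nat -> G,
  [/\ w 0%N = 1%g, w (wordlen g) = g,
   forall i, (i < wordlen g)%N -> cayley_adj S (w i) (w i.+1) &
   forall i j, (i <= j)%N -> (j <= wordlen g)%N ->
     wordlen ((w i)^-1 * w j)%g = (j - i)%N].
Proof.
have [s [sl sg] sz] := wordlen_word g.
have wordP (t : seq G) : (forall x, x \in t -> letter x) -> word t (gprod t) by [].
have mid i j : (i <= j)%N ->
    gprod (take j s) = (gprod (take i s) * gprod (take (j - i) (drop i s)))%g.
  by move=> ij; rewrite -gprod_cat -takeD subnKC.
have midl i j x : x \in take (j - i) (drop i s) -> letter x.
  by move=> /mem_take/mem_drop/sl.
exists (fun i => gprod (take i s)); split.
- by rewrite take0.
- by rewrite -sz take_size.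
- move=> i; rewrite -sz => iS; apply/cayley_adjE.
  rewrite (mid i i.+1) // mulKg subSnn (drop_nth 1%g iS) /= take0 /= mulg1.
  by apply: sl; exact: mem_nth.
move=> i j ij; rewrite -sz => js; apply/eqP; rewrite eqn_leq; apply/andP; split.
  rewrite (mid i j) // mulKg; apply: leq_trans (wordlen_le (wordP _ (@midl i j))) _.
  by rewrite size_take_min size_drop; lia.
have W1 : (wordlen (gprod (take i s)) <= i)%N.
  apply: leq_trans (wordlen_le (wordP _ _)) _; first by move=> x /mem_take/sl.
  by rewrite size_take_min; lia.
have W2 : (wordlen (gprod (drop j s)) <= size s - j)%N.
  apply: leq_trans (wordlen_le (wordP _ _)) _; first by move=> x /mem_drop/sl.
  by rewrite size_drop.
have gE : g = (gprod (take i s) * ((gprod (take i s))^-1 * gprod (take j s)) *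
  gprod (drop j s))%g.
  by rewrite mulVKg -gprod_cat cat_take_drop.
have := wordlenM (gprod (take i s) * ((gprod (take i s))^-1 * gprod (take j
  s)))%g (gprod (drop j s)).
have := wordlenM (gprod (take i s)) ((gprod (take i s))^-1 * gprod (take j s))%g.
by rewrite -gE -sz; lia.
Qed.

Lemma letters_finite : finite_set [set x | letter x].
Proof.
apply: (@sub_finite_set _ _ (gens S `|` (fun x => x^-1)%g @` gens S)).
  by move=> x [?|?]; [left|right; exists x^-1%g; rewrite ?invgK].
by rewrite finite_setU; split; [|apply: finite_image]; exact: gens_finite.
Qed.

Lemma wordlen_word_length : word_length wordlen.
Proof.
split.
- by apply/eqP; rewrite -leqn0; apply: (@wordlen_le _ [::]); split=> // x;
  rewrite in_nil.
- have le g : (wordlen g^-1%g <= wordlen g)%N.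
    have [s sg <-] := wordlen_word g.
    by apply: leq_trans (wordlen_le (word_inv sg)) _; rewrite size_rev size_map.
  by move=> g; apply/eqP; rewrite eqn_leq le -{1}[g]invgK le.
- exact: wordlenM.
- elim=> [|n IH].
    apply: (@sub_finite_set _ _ [set 1%g]); last exact: finite_set1.
    move=> g /=; rewrite leqn0 => /eqP g0; have [s [_ sg] sz] := wordlen_word g.
    by move/eqP: sz; rewrite g0 size_eq0 => /eqP s0; rewrite -sg s0.
  apply: (@sub_finite_set _ _
    ([set (x * y)%g | x in [set x | letter x] & y in [set y | (wordlen y <= n)%N]]
      `|` [set 1%g])).
    move=> g /= gn; have [[|x s] [sl sg] sz] := wordlen_word g; first by right.
    left; exists x; first by apply: sl; rewrite inE eqxx.
    exists (gprod s) => //=; apply: (@leq_trans (size s)).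
      by apply: wordlen_le; split=> // y ys; apply: sl; rewrite inE ys orbT.
    by move: gn; rewrite -sz.
  rewrite finite_setU; split; last exact: finite_set1.
  exact: finite_image2 letters_finite IH.
- by move=> g; have [w [? ? _ ?]] := wordlen_prefix g; exists w.
Qed.

End WordLengthOfGenerators.

Section CayleyGeometry.
Context (R : realType) (G : groupType) (S : generating_set G).
Implicit Types (g h : G) (x y z : cayley R S).

Local Notation vertex := (vertex R S).

Lemma mdist_pseudometric (X : metricType R) : pseudometric (@mdist R X).
Proof.
split; [exact: mdistxx|exact: metric_sym|].
by move=> x y z; exact: metric_triangle.
Qed.

Lemma edge_point0 g h : edge_point g h (0 : R) = bary (vertex g).
Proof. by apply/funext => k; rewrite /= /edge_point !mul0r. Qed.

Lemma edge_point1 g h : edge_point g h (1 : R) = bary (vertex h).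
Proof. by apply/funext => k; rewrite /= /edge_point subrr subr0 !mul0r !mul1r
  addrC. Qed.

Lemma mdist_edge g h s t x y : cayley_adj S g h -> 0 <= s <= 1 -> 0 <= t <= 1 ->
  bary x = edge_point g h s -> bary y = edge_point g h t -> mdist x y <= `|s - t|.
Proof.
move=> gh s01 t01 xs yt.
have := cayley_path_cons gh s01 t01 xs yt (cayley_path_nil y).
by rewrite addr0 => /cayley_dist_le.
Qed.

(* With [w] a word length, this bounds the distances of the Cayley graph from
   below. *)
Lemma edge_point_interpolation (w : G -> R) g h g' h' (s s' : R) :
  edge_point g h s = edge_point g' h' s' ->
  (1 - s) * w g + s * w h = (1 - s') * w g' + s' * w h'.
Proof.
pose r := undup [:: g; h; g'; h'].
have sumE k : k \in r -> \sum_(i <- r) (i == k)%:R * w i = w k.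
  move=> kr; rewrite (bigD1_seq k) ?undup_uniq //= eqxx mul1r big1 ?addr0 //.
  by move=> i /negbTE ->; rewrite mul0r.
have E a b (t : R) : a \in r -> b \in r ->
    \sum_(i <- r) edge_point a b t i * w i = (1 - t) * w a + t * w b.
  move=> ar br; rewrite -(sumE a ar) -(sumE b br) !big_distrr /= -big_split /=.
  by apply: eq_bigr => i _; rewrite /edge_point mulrDl -!mulrA.
move=> ee; rewrite -(E g h s) ?ee ?(E g' h' s') //;
  by rewrite /r mem_undup !inE eqxx ?orbT.
Qed.

(** A function that is 1-Lipschitz on adjacent vertices extends linearly over the edges and varies
    along a segment by at most its length. *)
Lemma cayley_path_interpolation (w : G -> R) x y l :
  (forall g h, cayley_adj S g h -> `|w g - w h| <= 1) -> cayley_path x y l ->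
  forall g h s g' h' s', bary x = edge_point g h s ->
    bary y = edge_point g' h' s' ->
  `|(1 - s) * w g + s * w h - ((1 - s') * w g' + s' * w h')| <= l.
Proof.
move=> wL; elim=> {x y l} [x|g h s t x y z l gh s01 t01 xs yt _ IH] g1 h1 s1 g2
  h2 s2.
  by move=> -> /(edge_point_interpolation w) ->; rewrite subrr normr0.
rewrite xs => /(edge_point_interpolation w) <- z2.
have := IH _ _ _ _ _ _ yt z2; set a := (1 - t) * w g + t * w h;
  set b := (1 - s) * w g + s * w h.
set c := (1 - s2) * w g2 + s2 * w h2.
move=> ac; have -> : b - c = (b - a) + (a - c) by ring.
apply: (le_trans (ler_normD _ _)); apply: lerD; last exact: ac.
have -> : b - a = (s - t) * (w h - w g) by rewrite /a /b; ring.
by rewrite normrM ler_piMr // distrC; exact: wL.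
Qed.

Lemma mdist_vertex g h : mdist (vertex g) (vertex h) = wdist R (wordlen S) g h.
Proof.
have wP := wordlen_word_length S.
apply/eqP; rewrite eq_le; apply/andP; split; last first.
  apply: lb_le_inf; first exact: cayley_path_exists.
  move=> l pl; pose w k : R := (wordlen S (g^-1 * k)%g)%:R.
  have wL a b : cayley_adj S a b -> `|w a - w b| <= 1.
    move=> ab; have l1 : (wordlen S (a^-1 * b)%g <= 1)%N.
      apply: (@wordlen_le _ _ _ [:: (a^-1 * b)%g]); split; last by rewrite /= mulg1.
      by move=> x; rewrite inE => /eqP ->; apply/cayley_adjE.
    have := wlM wP (g^-1 * a)%g (a^-1 * b)%g; rewrite -mulgA mulVKg.
    have := wlM wP (g^-1 * b)%g (a^-1 * b)^-1%g;
      rewrite (wlV wP) invgM invgK -mulgA mulVKg.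
    move=> L1 L2; have {}L1 : (wordlen S (g^-1 * a)%g <= wordlen S (g^-1 * b)%g +
      1)%N
      by apply: leq_trans L1 _; rewrite leq_add2l.
    have {}L2 : (wordlen S (g^-1 * b)%g <= wordlen S (g^-1 * a)%g + 1)%N
      by apply: leq_trans L2 _; rewrite leq_add2l.
    move: L1 L2; rewrite -!(ler_nat R) !natrD -/(w a) -/(w b) ler_norml; lra.
  have := cayley_path_interpolation wL pl (g := g) (h := g) (s := 0) (g' :=
    h) (h' := h)
    (s' := 0) erefl erefl.
  rewrite !subr0 !mul0r !addr0 !mul1r /w mulVg (wl1 wP) sub0r normrN ger0_norm //.
have [v [v0 vn vadj _]] := wordlen_prefix S (g^-1 * h)%g.
set n := wordlen S _ in vn vadj.
have step i : (i <= n)%N -> mdist (vertex g) (vertex (g * v i)%g) <= i%:R.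
  elim: i => [|i IH] iN; first by rewrite v0 mulg1 mdistxx.
  have := metric_triangle (vertex g) (vertex (g * v i)%g) (vertex (g * v i.+1)%g).
  have := IH (ltnW iN).
  have adj : cayley_adj S (g * v i)%g (g * v i.+1)%g.
    by apply/cayley_adjE; rewrite invgM -mulgA mulKg; apply/cayley_adjE;
      exact: vadj.
  have := mdist_edge (s := 0) (t := 1) (x := vertex (g * v i)%g)
    (y := vertex (g * v i.+1)%g) adj _ _ (esym (edge_point0 _ _)) (esym
      (edge_point1 _ _)).
  by rewrite !lexx !ler01 sub0r normrN normr1 -natr1 => /(_ isT isT); lra.
by have := step n (leqnn n); rewrite vn mulVKg.
Qed.

Lemma vertex_near x : exists g, mdist x (vertex g) <= 1.
Proof.
have [g [h [t [[<-|gh] t01 xt]]]] := baryP x; exists g.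
  suff -> : x = vertex g by rewrite mdistxx ler01.
  apply: bary_inj; rewrite xt; apply/funext => k /=.
  by rewrite /edge_point -!mulrDl subrK subr0 addr0.
apply: le_trans (mdist_edge gh t01 (t := 0) _ xt (esym (edge_point0 _ _))) _.
  by rewrite lexx ler01.
by rewrite subr0 ger0_norm; lra.
Qed.

(** Run through the edges of a shortest word at unit speed. The path does not increase distances,
    and equality at its two ends forces equality in between. *)
Lemma geodesic_exists g h : exists (n : R) (c : R -> cayley R S),
  [/\ geodesic 0 n c, c 0 = vertex g & c n = vertex h].
Proof.
have wP := wordlen_word_length S.
have [v [v0 vn vadj vd]] := wordlen_prefix S (g^-1 * h)%g.
set n := wordlen S _ in vn vadj vd.
have [n0|npos] := posnP n.
  have gh : g = h by rewrite -[h](mulVKg g) -vn n0 v0 mulg1.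
  exists 0, (fun=> vertex g); rewrite gh; split=> //; split=> // s t.
  rewrite !in_itv /= => ? ?; rewrite mdistxx; have -> : s - t = 0 by lra.
  by rewrite normr0.
pose u i := (g * v i)%g.
have uadj i : (i < n)%N -> cayley_adj S (u i) (u i.+1).
  by move=> iN; apply/cayley_adjE; rewrite /u invgM -mulgA mulKg;
    apply/cayley_adjE; exact: vadj.
pose P t x := exists i, [/\ (i < n)%N, i%:R <= t <= i.+1%:R &
  bary x = edge_point (u i) (u i.+1) (t - i%:R)].
have exP t : exists x, 0 <= t <= n%:R -> P t x.
  have [tn|tn] := pselect (0 <= t <= n%:R); last by exists (vertex g).
  have [i [iN it]] : exists i, (i < n)%N /\ i%:R <= t <= i.+1%:R.
    have t0 : 0 <= t by lra.
    have := truncn_itv t0; have [lt|ge] := ltnP (Num.truncn t) n; last first.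
      move=> _; exists n.-1; rewrite prednK //; split; first by lia.
      have : (n%:R : R) <= t by apply: le_trans (_ : (Num.truncn t)%:R <= t);
        rewrite ?ler_nat // truncn_le.
      have : (n.-1%:R : R) <= n%:R by rewrite ler_nat leq_pred.
      lra.
    by move=> H; exists (Num.truncn t); split=> //; lra.
  have it01 : 0 <= t - i%:R <= 1 by rewrite -natr1 in it; lra.
  have ok : exists a b (r : R), [/\ a = b \/ cayley_adj S a b, 0 <= r <= 1 &
      edge_point (u i) (u i.+1) (t - i%:R) = edge_point a b r].
    by exists (u i), (u i.+1), (t - i%:R); split=> //; right; exact: uadj.
  by exists (CayleyPoint ok) => _; exists i.
have [c cP] := choice exP.
have uv i j : (i <= j)%N -> (j <= n)%N -> mdist (vertex (u i)) (vertex (u j)) =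
  (j - i)%N%:R.
  by move=> ij jn; rewrite mdist_vertex /u wdist_translate /wdist vd.
have low t i : (i < n)%N -> i%:R <= t <= i.+1%:R ->
    bary (c t) = edge_point (u i) (u i.+1) (t - i%:R) ->
    mdist (c t) (vertex (u i)) <= t - i%:R /\ mdist (c t) (vertex (u i.+1)) <=
      i.+1%:R - t.
  move=> iN it ct; rewrite -natr1 in it *; split.
    apply: le_trans (mdist_edge (uadj i iN) _ (t :=
      0) _ ct (esym (edge_point0 _ _))) _; try lra.
    by rewrite subr0 ger0_norm //; lra.
  apply: le_trans (mdist_edge (uadj i iN) _ (t :=
    1) _ ct (esym (edge_point1 _ _))) _; try lra.
  by rewrite distrC ger0_norm; lra.
have up s t : 0 <= s -> s <= t -> t <= n%:R -> mdist (c s) (c t) <= t - s.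
  move=> s0 st tn.
  have [|i [iN is_ ci]] := cP s; first by lra.
  have [|j [jN jt cj]] := cP t; first by lra.
  have [li1 li2] := low s i iN is_ ci; have [lj1 lj2] := low t j jN jt cj.
  have [ij|ji|ij] := ltngtP i j.
  - have T1 := metric_triangle (c s) (vertex (u i.+1)) (c t).
    have T2 := metric_triangle (vertex (u i.+1)) (vertex (u j)) (c t).
    rewrite uv // ?natrB // in T2; last by exact: ltnW.
    rewrite [mdist (vertex (u j)) _]metric_sym in T2; lra.
  - have st' : s = t.
      have : (j.+1%:R : R) <= i%:R by rewrite ler_nat.
      lra.
    by rewrite st' mdistxx subrr.
  - rewrite ij in ci is_.
    apply: le_trans (mdist_edge (uadj j jN) _ _ ci cj) _.
    + by rewrite -natr1 in is_; lra.
    + by rewrite -natr1 in jt; lra.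
    + have -> : s - j%:R - (t - j%:R) = - (t - s) by ring.
      by rewrite normrN ger0_norm //; lra.
have n0R : (0 : R) <= n%:R by exact: ler0n.
have c0 : c 0 = vertex g.
  have [|i [iN i0 ci]] := cP 0; first by lra.
  have iz : i = 0%N.
    by apply/eqP; rewrite -leqn0 -(ler_nat R); lra.
  by apply: bary_inj; rewrite ci iz subr0 edge_point0 /u v0 mulg1.
have cn : c n%:R = vertex h.
  have [|i [iN i0 ci]] := cP n%:R; first by lra.
  have iz : n = i.+1.
    by apply/eqP; rewrite eqn_leq iN andbT -(ler_nat R); lra.
  apply: bary_inj; rewrite ci [in n%:R]iz -natr1 [_ + 1 - _]addrAC subrr add0r
    edge_point1.
  by rewrite -iz /u vn mulVKg.
exists n%:R, c; split=> //; split=> // s t; rewrite !in_itv /= => sn tn.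
have dn : mdist (c 0) (c n%:R) = n%:R.
  by rewrite c0 cn mdist_vertex.
suff H a b : 0 <= a -> a <= b -> b <= n%:R -> mdist (c a) (c b) = b - a.
  have [st|/ltW ts] := leP s t.
    by rewrite distrC ger0_norm ?H //; lra.
  by rewrite metric_sym ger0_norm ?H //; lra.
move=> a0 ab bn; have U := up a b a0 ab bn.
have U1 := up 0 a (lexx _) a0 (le_trans ab bn).
have U2 := up b n%:R (le_trans a0 ab) bn (lexx _).
have T1 := metric_triangle (c 0) (c a) (c n%:R).
have T2 := metric_triangle (c a) (c b) (c n%:R).
lra.
Qed.

End CayleyGeometry.

(** * Quasigeodesics and Hausdorff distance in explicit form *)

Section MetricTranslation.
Context (R : realType) (X : metricType R).
Implicit Types (f g : R -> X) (l c a b s t E : R).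

Lemma quasigeodesicP l c a b f : 0 < l ->
  quasigeodesic l c `[a, b] f <-> qgeod (@mdist R X) l c a b f.
Proof.
move=> l0; have mR (x y : R) : mdist (x : R^o) (y : R^o) = `|x - y|.
  by rewrite /mdist /= distrC.
have E x y : (l^-1 * mdist (f x) (f y) - c <= `|x - y|) = (mdist (f x) (f y) <= l
  * (`|x - y| + c)).
  by rewrite lerBlDr -(ler_pM2l l0) mulVKf // gt_eqF.
split=> [[_ qf] s t sab tab|qf].
  have [] := qf s t; rewrite /= ?in_itv //= mR E; by split.
split; first exact: interval_is_interval.
by move=> x y; rewrite /= !in_itv /= mR E => xab yab; exact: qf.
Qed.

Lemma hausdorff_fellow E s t a b f g : s <= t ->
  fellow (@mdist R X) E f s t g a b ->
  (hausdorff_distance (f @` `[s, t]) (g @` `[a, b]) <= E%:E)%E.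
Proof.
move=> st [H1 H2]; rewrite /hausdorff_distance ge_max; apply/andP; split.
  apply: ge_ereal_sup => _ [_ [v + <-] <-]; rewrite /= ?in_itv /= => vst.
  have [|w wab dw] := H1 v; first by left.
  apply: (@le_trans _ _ (mdist (f v) (g w))%:E); last by rewrite lee_fin.
  apply: ereal_inf_lbound; exists (g w) => //; exists w.
apply: ge_ereal_sup => _ [_ [w + <-] <-]; rewrite /= ?in_itv /= => wab.
have [v vst dw] := H2 w wab.
apply: (@le_trans _ _ (mdist (f v) (g w))%:E); last by rewrite lee_fin.
apply: ereal_inf_lbound; exists (f v) => //; exists v => //.
by rewrite /= ?in_itv /=; case: vst; lra.
Qed.

(** The infima in the Hausdorff distance need not be attained, which costs [1]. *)
Lemma fellow_hausdorff E s t a b f g : s <= t ->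
  (hausdorff_distance (f @` `[s, t]) (g @` `[a, b]) <= E%:E)%E ->
  fellow (@mdist R X) (E + 1) f s t g a b.
Proof.
have EE : (E%:E < (E + 1)%:E)%E by rewrite lte_fin ltrDl ltr01.
move=> st; rewrite /hausdorff_distance ge_max => /andP[H1 H2]; split.
  move=> v vst; have vst' : s <= v <= t by case: vst; lra.
  have : (ereal_inf [set (mdist (f v) y)%:E | y in g @` `[a, b]] <= E%:E)%E.
    apply: le_trans H1; apply: ereal_sup_ubound; exists (f v) => //.
  move=> /le_lt_trans/(_ EE)/ereal_inf_lt[_ [_ [w + <-] <-]].
  by rewrite /= ?in_itv lte_fin /= => wab dw; exists w => //; exact: ltW.
move=> w wab.
have : (ereal_inf [set (mdist x (g w))%:E | x in f @` `[s, t]] <= E%:E)%E.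
  apply: le_trans H2; apply: ereal_sup_ubound; exists (g w) => //.
move=> /le_lt_trans/(_ EE)/ereal_inf_lt[_ [_ [v + <-] <-]].
rewrite /= ?in_itv lte_fin /= => vst dw; exists v; first by left.
exact: ltW.
Qed.

Lemma morse_morse_path M a b f : morse M `[a, b] f ->
  morse_path (@mdist R X) (fun l c => M l c + 1) a b f.
Proof.
move=> mf; apply: morse_path_ordered => l c l1 c0 s t as_ st tb a' b' g ab qg gs gt.
apply: fellow_hausdorff => //; apply: mf => //.
- by rewrite /= ?in_itv /=; lra.
- by rewrite /= ?in_itv /=; lra.
- by apply/quasigeodesicP => //; lra.
Qed.

End MetricTranslation.

(** * Passage between the Cayley graph and its vertices *)

Section Discretization.
Context (R : realType) (G : groupType) (S : generating_set G).
Local Notation vertex := (vertex R S).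
Local Notation dG := (wdist R (wordlen S)).
Local Notation dC := (@mdist R (cayley R S)).

Let wlP := wordlen_word_length S.
Let dCP := mdist_pseudometric (cayley R S).
Let dGP := wdist_pseudometric R wlP.

Lemma qgeod_vertex (l c a b : R) (f : R -> G) :
  qgeod dG l c a b f <-> qgeod dC l c a b (fun t => vertex (f t)).
Proof.
by split=> qf s t sab tab; have := qf s t sab tab; rewrite mdist_vertex.
Qed.

Lemma round_exists : exists rd : cayley R S -> G, forall x,
  dC x (vertex (rd x)) <= 1.
Proof. by have [rd rdP] := choice (@vertex_near R G S); exists rd. Qed.

Lemma qgeod_round (rd : cayley R S -> G) (l c a b : R) (f : R -> cayley R S) :
  (forall x, dC x (vertex (rd x)) <= 1) -> 1 <= l -> 0 <= c ->
  qgeod dC l c a b f -> qgeod dG l (c + 2 * l) a b (rd \o f).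
Proof.
move=> rdP l1 c0 qf s t sab tab; rewrite /= -mdist_vertex.
have [q1 q2] := qf s t sab tab.
have r1 := rdP (f s); have r2 := rdP (f t).
have T1 := pm_tri dCP (vertex (rd (f s))) (f s) (vertex (rd (f t))).
have T2 := pm_tri dCP (f s) (f t) (vertex (rd (f t))).
have T3 := pm_tri dCP (f s) (vertex (rd (f s))) (f t).
have T4 := pm_tri dCP (vertex (rd (f s))) (vertex (rd (f t))) (f t).
rewrite [dC (vertex (rd (f s))) (f s)](pm_sym dCP) in T1.
rewrite [dC (vertex (rd (f t))) (f t)](pm_sym dCP) in T4.
set D := dC (vertex _) (vertex _) in T1 T4 *.
have lD : l * dC (f s) (f t) <= l * (D + 2) by apply: ler_wpM2l; lra.
have ll : 2 <= l * (2 * l) by have := le_mulR l1 (_ : 0 <= 2 * l); lra.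
split; lra.
Qed.

Lemma stable_wrt_dstable (M : R -> R -> R) (mu : R) (H : set G) :
  is_subgroup H -> stable_wrt S M mu H -> dstable R (wordlen S) H.
Proof.
move=> sH stH; have [rd rdP] := round_exists.
(* The three units come from the infima in the Hausdorff distance, from the endpoints moved by [1]
   in [morse_coarse] and from rounding [f] to vertices. *)
pose D l c : R := M l (c + 2 * l * 1 + 2) + 1 + 1 + 1.
apply: (@dstable_intro R G (wordlen S) wlP D (mu + 1) 1 _ sH) => h Hh.
have [n [f [geo f0 fn]]] := geodesic_exists R S 1%g h.
have [||mf fH] := stH 0 n f geo.
- by exists 1%g => //; exact: subgroup1.
- by exists h.
have n0 : 0 <= n by have [] := geo.
have mf' := morse_morse_path mf.
exists 0, n, (rd \o f); split=> //.
- by rewrite /= -mdist_vertex -f0; exact: rdP.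
- by rewrite /= -mdist_vertex -fn; exact: rdP.
- move=> l c l1 c0 s t sn tn a' b' g ab /qgeod_vertex qg gs gt.
  have [||H1 H2] := morse_coarse dCP mf' l1 c0 ler01 sn tn ab qg.
  + by rewrite gs (pm_sym dCP); exact: rdP.
  + by rewrite gt (pm_sym dCP); exact: rdP.
  split=> [v /H1[w wab dw]|w /H2[v vst dv]].
    exists w => //=; rewrite -mdist_vertex.
    have := pm_tri dCP (vertex (rd (f v))) (f v) (vertex (g w)).
    by have := rdP (f v); rewrite (pm_sym dCP); rewrite /D; lra.
  exists v => //=; rewrite -mdist_vertex.
  have := pm_tri dCP (vertex (rd (f v))) (f v) (vertex (g w)).
  by have := rdP (f v); rewrite (pm_sym dCP); rewrite /D; lra.
- move=> t tn; have [|k Hk dk] := fH t; first by rewrite in_itv.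
  exists k => //=; rewrite -mdist_vertex.
  have := pm_tri dCP (vertex (rd (f t))) (f t) (vertex k).
  by have := rdP (f t); rewrite (pm_sym dCP); lra.
Qed.

(** [D] is an arbitrary function and controls only paths of vertices, while the hypothesis asks for
    a Morse gauge on the Cayley graph. The set [V l c] of constants valid for all [D]-Morse paths is
    nonempty by rounding, and [inf (V l c) + 1] serves as the gauge. *)
Lemma discrete_mltg_cayley : morse_local_to_global (cayley R S) ->
  discrete_mltg R (wordlen S).
Proof.
move=> mltg D C C0; have [rd rdP] := round_exists.
pose V (l c : R) : set R := [set E | 0 <= E /\
  forall f a b, morse_path dG D a b f -> forall s t, a <= s -> s <= t -> t <= b ->
  forall a' b' g, a' <= b' -> qgeod dC l c a' b' g -> g a' = vertex (f s) ->
    g b' = vertex (f t) -> fellow dC E (fun v => vertex (f v)) s t g a' b'].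
have V_ex l c : 1 <= l -> 0 <= c -> V l c !=set0.
  move=> l1 c0; pose E := D l (c + 2 * l + 2 * l * 1 + 2) + 1 + 1.
  exists (Num.max 0 E); split; first by rewrite le_max lexx.
  move=> f a b mf s t as_ st tb a' b' g ab qg gs gt.
  apply: (@fellow_le _ _ _ E); first by rewrite le_max lexx orbT.
  have c1 : 0 <= c + 2 * l by lra.
  have [||||H1 H2] := morse_coarse dGP mf l1 c1 ler01 (s := s) (t := t) _ _ ab
    (qgeod_round rdP l1 c0 qg); [lra|lra| | |].
  - by rewrite /= gs -mdist_vertex (pm_sym dCP); exact: rdP.
  - by rewrite /= gt -mdist_vertex (pm_sym dCP); exact: rdP.
  have cl v w : dG (f v) (rd (g w)) <= E - 1 -> dC (vertex (f v)) (g w) <= E.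
    rewrite -mdist_vertex => dvw.
    have := pm_tri dCP (vertex (f v)) (vertex (rd (g w))) (g w).
    by have := rdP (g w); rewrite (pm_sym dCP); lra.
  split=> [v /H1[w wab dw]|w /H2[v vst dv]].
    by exists w => //; apply: cl; rewrite /E addrK.
  by exists v => //; apply: cl; rewrite /E addrK.
have V_inf l c : 1 <= l -> 0 <= c -> has_inf (V l c).
  by move=> l1 c0; split; [exact: V_ex|exists 0 => E []].
pose M l c := inf (V l c) + 1.
(* The infimum of all the admissible constants is monotone in [l] and [c]. *)
have gM : morse_gauge M.
  split=> [l c l1 c0|l c l' c' l1 c0 ll cc].
    suff : 0 <= inf (V l c) by rewrite /M; lra.
    by apply: lb_le_inf => [|E []//]; exact: V_ex.
  rewrite /M lerD2r; apply: lb_le_inf; first by apply: V_ex; lra.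
  move=> E [E0 HE]; apply: ge_inf; first exact: (V_inf l c l1 c0).2.
  split=> // f a b mf s t as_ st tb a' b' g ab qg; apply: (HE f a b mf s t) => //.
  by apply: (qgeod_weaken dCP _ _ _ _ qg); lra.
have [L [M' [l' [c' [L0 gM' l1' c0' H]]]]] := mltg M 1 C gM (lexx _) C0.
exists L, (fun l c => M' l c + 1), l', c'; split=> // b f b0 loc.
have [|qf mf] := H `[0, b]%classic (fun t => vertex (f t)).
  split; first exact: interval_is_interval.
  move=> t1 t2; rewrite /= !in_itv /= => t1b t2b t12 tL.
  have [qf mf] : good (wordlen S) D C t1 t2 f by apply: loc => //; lra.
  split; first by apply/quasigeodesicP; [lra|exact/qgeod_vertex].
  move=> l c l1 c0 a' b' s t g ab st; rewrite /= !in_itv /= => st1 tt1 qg gs gt.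
  apply: hausdorff_fellow => //.
  have [E [E0 VE] EM] := inf_adherent ltr01 (V_inf l c l1 c0).
  apply: (fellow_le (ltW EM)).
  apply: (VE f t1 t2 mf) => //; try lra.
  by apply/quasigeodesicP => //; lra.
split; first by apply/qgeod_vertex/quasigeodesicP => //; lra.
have mf' := morse_morse_path mf.
move=> l c l1 c0 s t sb tb a' b' g ab /qgeod_vertex qg gs gt.
have [||H1 H2] := mf' l c l1 c0 s t sb tb _ _ _ ab qg; rewrite ?gs ?gt //.
split=> [v /H1[w wab dw]|w /H2[v vst dv]].
  by exists w => //; rewrite -mdist_vertex.
by exists v => //; rewrite -mdist_vertex.
Qed.

End Discretization.

(** * Independence of the generating set *)

Section ChangeOfGenerators.
Context (R : realType) (G : groupType).

Lemma wordlen_bounded (S S' : generating_set G) : exists K : nat, forall g,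
  (wordlen S' g <= K * wordlen S g)%N.
Proof.
have [|x m n mn|x _|K KP] := @finite_bounded G [set x | letter S x]
  (fun x n => (wordlen S' x <= n)%N).
- exact: letters_finite.
- by move=> xm; exact: leq_trans mn.
- by exists (wordlen S' x).
exists K => g; have [s [sl <-] <-] := wordlen_word S g.
elim: s sl => [|x s IH] sl /=; first by rewrite (wl1 (wordlen_word_length S')).
apply: leq_trans (wordlenM S' x (gprod s)) _; rewrite mulnS.
apply: leq_add; first by apply: KP; apply: sl; rewrite inE eqxx.
by apply: IH => y ys; apply: sl; rewrite inE ys orbT.
Qed.

(** The two word metrics are bilipschitz with constant [K], so an [(l, c)]-quasigeodesic for [d'] is
    a [(K * l, c)]-quasigeodesic for [d]. The old leash remains a Morse path for [d'], from which
    [dstable_intro] makes a new one. *)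
Lemma dstable_change (S S' : generating_set G) (H : set G) :
  dstable R (wordlen S) H -> dstable R (wordlen S') H.
Proof.
move=> [D [mu [sH lH]]].
have [K1 K1P] := wordlen_bounded S S'; have [K2 K2P] := wordlen_bounded S' S.
pose K : R := (K1 + K2).+1%:R.
have K_ge1 : 1 <= K by rewrite ler1n.
pose d := wdist R (wordlen S); pose d' := wdist R (wordlen S').
have dd' x y : d' x y <= K * d x y.
  rewrite /d /d' /K /wdist -natrM ler_nat; apply: leq_trans (K1P _) _.
  by apply: leq_mul => //; lia.
have d'd x y : d x y <= K * d' x y.
  rewrite /d /d' /K /wdist -natrM ler_nat; apply: leq_trans (K2P _) _.
  by apply: leq_mul => //; lia.
have wlP' := wordlen_word_length S'.
have d'P := wdist_pseudometric R wlP'; have dP :=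
  wdist_pseudometric R (wordlen_word_length S).
apply: (@dstable_intro R G _ wlP' (fun l c => K * D (K * l) c) (K * mu) 0 _ sH)
  => h /lH.
move=> [b [f [b0 [f0 fb] qf mf fH]]]; exists 0, b, f; rewrite f0 fb !(pmxx d'P).
split=> //.
  move=> l c l1 c0 s t sb tb a' b' g ab qg gs gt.
  have Kl : 1 <= K * l by apply: le_trans K_ge1 _; rewrite mulrC;
    apply: le_mulR => //; lra.
  have qg' : qgeod d (K * l) c a' b' g.
    move=> u v uab vab; have [q1 q2] := qg u v uab vab; split.
      apply: le_trans (d'd _ _) _; rewrite -mulrA; apply: ler_wpM2l q1; lra.
    apply: le_trans q2 _; rewrite lerD2r [K * l]mulrC -mulrA;
      apply: ler_wpM2l => //; lra.
  have K0 : 0 <= K by lra.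
  have [H1 H2] := mf _ _ Kl c0 s t sb tb a' b' g ab qg' gs gt.
  split=> [v /H1[w wab dw]|w /H2[v vst dv]].
    by exists w => //; apply: le_trans (dd' _ _) _; apply: ler_wpM2l.
  by exists v => //; apply: le_trans (dd' _ _) _; apply: ler_wpM2l.
move=> t /fH[k Hk dk]; exists k => //; apply: le_trans (dd' _ _) _.
by apply: ler_wpM2l => //; lra.
Qed.

End ChangeOfGenerators.

(** * Setwise products as products over lists of subgroups *)

Lemma inseq_nth (G : groupType) (As : seq (set G)) (ys : seq G) k :
  inseq As ys -> (k < size As)%N -> nth set0 As k (nth 1%g ys k).
Proof. by elim: As ys k => [|A As IH] [|y ys] //= [|k] /= [Ay ysA] kA //;
  exact: IH. Qed.

Lemma prodset_set_product (G : groupType) (n : nat) (H : 'I_n -> set G) :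
  set_product H = prodset (map H (enum 'I_n)).
Proof.
have prodE (h : 'I_n -> G) : (\prod_(i < n) h i)%g = gprod (map h (enum 'I_n)).
  by rewrite /gprod foldrE big_map enumT [index_enum _]unlock.
apply/seteqP; split=> x [].
  move=> h hH <-; exists (map h (enum 'I_n)); last by rewrite prodE.
  by rewrite /=; elim: (enum 'I_n) => //= i s IH; split=> //; exact: hH.
move=> ys ysH <-; have szE := inseq_size ysH.
rewrite size_map size_enum_ord in szE.
exists (fun i => nth 1%g ys i).
  move=> i /=; have : forall k, (k < n)%N -> nth set0 (map H (enum 'I_n)) k (nth
    1%g ys k).
    move=> k kn; apply: inseq_nth => //.
    by rewrite size_map size_enum_ord.
  by move=> /(_ i (ltn_ord i)); rewrite (nth_map i) ?size_enum_ord ?nth_ord_enum.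
rewrite (prodE (fun i : 'I_n => nth 1%g ys i)); congr gprod;
  apply: (@eq_from_nth _ 1%g).
  by rewrite size_map size_enum_ord.
move=> k; rewrite size_map size_enum_ord => kn.
by rewrite (nth_map (Ordinal kn)) ?size_enum_ord // nth_enum_ord.
Qed.

Theorem corollary1p2 (R : realType) (G : groupType)
  (Gfg : finitely_generated [set: G]%classic)
  (Glerf : lerf G)
  (Gmltg : morse_local_to_global_group R G)
  (n : nat) (n_ge1 : (1 <= n)%N)
  (H : 'I_n -> set G) (Hstable : forall i, stable R (H i)) :
  separable (set_product H).
Proof.
have [S mltg] := Gmltg.
rewrite prodset_set_product.
apply: (products_separable (wordlen_word_length S) Glerf (discrete_mltg_cayley
  mltg) (leqnn _)).
move=> _ /mapP[i _ ->].
(* Each [H i] may come with its own generating set [S'], whereas the local-to-global property is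
   known for [S]. *)
have [sHi [S' [M [mu [_ _ stH]]]]] := Hstable i.
exact: dstable_change (stable_wrt_dstable sHi stH).
Qed.
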